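(* Consider the parametric constraint system $g(p,x)\in C$ under the standing assumptions, with solution map $\Gamma$ and $(\bar p,\bar x)\in\operatorname{gph}\Gamma$. Consider: (i) Robinson stability holds for the system at $(\bar p,\bar x)$; (ii) $\bar x$ is a parametrically stable solution on $P$ at $\bar p$, and the partial MSCQ and the partial BMP with respect to $x$ hold at $(\bar p,\bar x)$. Then (i) implies (ii), and $\operatorname{bmp}_x(g,C)(\bar p,\bar x)\le\operatorname{subreg}_x(g,C)(\bar p,\bar x)$. Conversely, if $C$ is subamenable at $g(\bar p,\bar x)$, then (ii) implies (i) and $\operatorname{subreg}_x(g,C)(\bar p,\bar x)=\operatorname{bmp}_x(g,C)(\bar p,\bar x)$.
   Context: $P$ is a topological space, $C\subset\mathbb{R}^l$ is closed, $g:P\times\mathbb{R}^n\to\mathbb{R}^l$, $\Gamma(p):=\{x\in\mathbb{R}^n: g(p,x)\in C\}$. Standing assumptions: there are neighborhoods $U$ of $\bar x$ and $V$ of $\bar p$ such that for each $p\in V$ the map $g(p,\cdot)$ is continuously differentiable on $U$, and both $g$ and $\nabla_x g$ are continuous at $(\bar p,\bar x)$. Robinson stability (RS) at $(\bar p,\bar x)$ with modulus $\kappa\ge0$: there are neighborhoods $U$ of $\bar x$, $V$ of $\bar p$ with $\operatorname{dist}(x;\Gamma(p))\le\kappa\operatorname{dist}(g(p,x);C)$ for all $(p,x)\in V\times U$ (with $\operatorname{dist}(x;\emptyset)=\infty$); $\operatorname{subreg}_x(g,C)(\bar p,\bar x)$ is the infimum of all such moduli. $\bar x$ is a parametrically stable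 solution on $P$ at $\bar p$ if for every neighborhood $U$ of $\bar x$ there is a neighborhood $V$ of $\bar p$ with $\Gamma(p)\cap U\neq\emptyset$ for all $p\in V$. Partial MSCQ at $(\bar p,\bar x)$: there are neighborhoods $V$ of $\bar p$, $U$ of $\bar x$ such that for every $p\in V$ and $x\in\Gamma(p)\cap U$ there exist a neighborhood $U_{p,x}$ of $x$ and $\kappa_{p,x}\ge0$ with $\operatorname{dist}(\xi;\Gamma(p))\le\kappa_{p,x}\operatorname{dist}(g(p,\xi);C)$ for all $\xi\in U_{p,x}$. Multiplier set $\Lambda(p,x,v)=\{\lambda\in N_C(g(p,x)):\nabla_xg(p,x)^T\lambda=v\}$. Partial BMP with modulus $\kappa$: there are neighborhoods $V$, $U$ with $\Lambda(p,x,v)\cap\kappa\|v\|\mathbb{B}_{\mathbb{R}^l}\ne\emptyset$ for all $p\in V$, $x\in\Gamma(p)\cap U$, $v\in N_{\Gamma(p)}(x)$; $\operatorname{bmp}_x(g,C)(\bar p,\bar x)$ is the infimum of such $\kappa$. $N$ is the limiting normal cone. A set $C$ is subamenable at $\bar z\in C$ if there are a neighborhood $W$ of $\bar z$, a $\mathcal C^1$ map $q:W\to\mathbb{R}^d$ and a closed convex set $Q\subset\mathbb{R}^d$ with $C\cap W=\{z\in W: q(z)\in Q\}$ and $z\mapsto q(z)-Q$ metrically subregular at $(\bar z,0)$ (metric subregularity of $F$ at $(\bar z,\bar y)$ with modulus $\kappa$: $\operatorname{dist}(z;F^{-1}(\bar y))\le\kappa\operatorname{dist}(\bar y;F(z))$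 for all $z$ near $\bar z$). *)

(* Defs.v *)
From Stdlib Require Import Reals.
From Stdlib Require Fin.
Open Scope R_scope.

Definition Vec (n : nat) := Fin.t n -> R.
Definition Mat (l n : nat) := Fin.t l -> Fin.t n -> R.

Fixpoint sumF (n : nat) : (Fin.t n -> R) -> R :=
  match n return (Fin.t n -> R) -> R with
  | O => fun _ => 0
  | S m => fun f => f Fin.F1 + sumF m (fun i => f (Fin.FS i))
  end.

Definition vsub {n} (x y : Vec n) : Vec n := fun i => x i - y i.
Definition dot {n} (x y : Vec n) : R := sumF n (fun i => x i * y i).
Definition norm {n} (x : Vec n) : R := sqrt (dot x x).

Definition matvec {l n} (J : Mat l n) (v : Vec n) : Vec l :=
  fun i => sumF n (fun j => J i j * v j).
Definition matTvec {l n} (J : Mat l n) (lam : Vec l) : Vec n :=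
  fun j => sumF l (fun i => J i j * lam i).
Definition matsub {l n} (A B : Mat l n) : Mat l n := fun i j => A i j - B i j.
Definition matnorm {l n} (A : Mat l n) : R :=
  sqrt (sumF l (fun i => sumF n (fun j => A i j * A i j))).

Record TopSpace := {
  pt :> Type;
  is_open : (pt -> Prop) -> Prop;
  open_full : is_open (fun _ => True);
  open_inter : forall A B, is_open A -> is_open B -> is_open (fun x => A x /\ B x);
  open_union : forall (F : (pt -> Prop) -> Prop),
      (forall A, F A -> is_open A) -> is_open (fun x => exists A, F A /\ A x)
}.

Definition nbhdP {P : TopSpace} (V : P -> Prop) (p : P) : Prop :=
  exists O, is_open P O /\ O p /\ (forall q, O q -> V q).

Definition nbhdR {n} (U : Vec n -> Prop) (x : Vec n) : Prop :=
  exists d, 0 < d /\ forall y, norm (vsub y x) < d -> U y.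

Definition seq_conv {n} (u : nat -> Vec n) (x : Vec n) : Prop :=
  forall eps, 0 < eps -> exists N, forall k, (N <= k)%nat -> norm (vsub (u k) x) < eps.

Definition closedV {n} (S : Vec n -> Prop) : Prop :=
  forall (u : nat -> Vec n) x, (forall k, S (u k)) -> seq_conv u x -> S x.

Definition openV {n} (W : Vec n -> Prop) : Prop :=
  forall x, W x -> nbhdR W x.

Definition convexV {n} (S : Vec n -> Prop) : Prop :=
  forall a b t, S a -> S b -> 0 <= t <= 1 ->
    S (fun i => (1 - t) * a i + t * b i).

(* dist(x; S) <= t, with dist(x; empty) = +infinity (then never <= t) *)
Definition dist_le {n} (x : Vec n) (S : Vec n -> Prop) (t : R) : Prop :=
  forall eps, 0 < eps -> exists y, S y /\ norm (vsub x y) <= t + eps.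

(* dist(x; S) <= kappa * dist(z; C), for kappa >= 0; unfolded through the
   infimum defining dist(z; C) *)
Definition dist_le_scaled {n l} (x : Vec n) (S : Vec n -> Prop)
    (kappa : R) (z : Vec l) (C : Vec l -> Prop) : Prop :=
  forall c, C c -> dist_le x S (kappa * norm (vsub z c)).

Definition has_jac {n l} (f : Vec n -> Vec l) (x : Vec n) (J : Mat l n) : Prop :=
  forall eps, 0 < eps -> exists d, 0 < d /\ forall y, norm (vsub y x) < d ->
    norm (vsub (vsub (f y) (f x)) (matvec J (vsub y x))) <= eps * norm (vsub y x).

Definition mat_cont_at {n l} (D : Vec n -> Mat l n) (x : Vec n) : Prop :=
  forall eps, 0 < eps -> exists d, 0 < d /\ forall y, norm (vsub y x) < d ->
    matnorm (matsub (D y) (D x)) < eps.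

Definition reg_normal {n} (S : Vec n -> Prop) (x v : Vec n) : Prop :=
  S x /\ forall eps, 0 < eps -> exists d, 0 < d /\ forall y, S y ->
    norm (vsub y x) < d -> dot v (vsub y x) <= eps * norm (vsub y x).

Definition lim_normal {n} (S : Vec n -> Prop) (x v : Vec n) : Prop :=
  S x /\ exists (xs vs : nat -> Vec n),
    (forall k, S (xs k)) /\ seq_conv xs x /\ seq_conv vs v /\
    (forall k, reg_normal S (xs k) (vs k)).

Section System.
Context {P : TopSpace} {n l : nat}.

Definition Gamma (g : P -> Vec n -> Vec l) (C : Vec l -> Prop) (p : P) : Vec n -> Prop :=
  fun x => C (g p x).

Definition standing (g : P -> Vec n -> Vec l) (Dg : P -> Vec n -> Mat l n)
    (pbar : P) (xbar : Vec n) : Prop :=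
  (exists U V, nbhdR U xbar /\ openV U /\ nbhdP V pbar /\
     forall p, V p -> forall x, U x -> has_jac (g p) x (Dg p x) /\ mat_cont_at (Dg p) x)
  /\ (forall eps, 0 < eps -> exists V d, nbhdP V pbar /\ 0 < d /\
        forall p x, V p -> norm (vsub x xbar) < d ->
          norm (vsub (g p x) (g pbar xbar)) < eps)
  /\ (forall eps, 0 < eps -> exists V d, nbhdP V pbar /\ 0 < d /\
        forall p x, V p -> norm (vsub x xbar) < d ->
          matnorm (matsub (Dg p x) (Dg pbar xbar)) < eps).

Definition RS_modulus (g : P -> Vec n -> Vec l) (C : Vec l -> Prop)
    (pbar : P) (xbar : Vec n) (kappa : R) : Prop :=
  0 <= kappa /\ exists U V, nbhdR U xbar /\ nbhdP V pbar /\
    forall p x, V p -> U x -> dist_le_scaled x (Gamma g C p) kappa (g p x) C.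

Definition robinson_stable g C pbar xbar : Prop :=
  exists kappa, RS_modulus g C pbar xbar kappa.

Definition param_stable (g : P -> Vec n -> Vec l) (C : Vec l -> Prop)
    (pbar : P) (xbar : Vec n) : Prop :=
  forall U, nbhdR U xbar -> exists V, nbhdP V pbar /\
    forall p, V p -> exists x, Gamma g C p x /\ U x.

Definition partial_MSCQ (g : P -> Vec n -> Vec l) (C : Vec l -> Prop)
    (pbar : P) (xbar : Vec n) : Prop :=
  exists V U, nbhdP V pbar /\ nbhdR U xbar /\
    forall p x, V p -> Gamma g C p x -> U x ->
      exists Upx kpx, nbhdR Upx x /\ 0 <= kpx /\
        forall xi, Upx xi -> dist_le_scaled xi (Gamma g C p) kpx (g p xi) C.

Definition multiplier (g : P -> Vec n -> Vec l) (Dg : P -> Vec n -> Mat l n)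
    (C : Vec l -> Prop) (p : P) (x v : Vec n) (lam : Vec l) : Prop :=
  lim_normal C (g p x) lam /\ matTvec (Dg p x) lam = v.

Definition BMP_modulus g Dg C (pbar : P) (xbar : Vec n) (kappa : R) : Prop :=
  0 <= kappa /\ exists V U, nbhdP V pbar /\ nbhdR U xbar /\
    forall p x v, V p -> Gamma g C p x -> U x -> lim_normal (Gamma g C p) x v ->
      exists lam, multiplier g Dg C p x v lam /\ norm lam <= kappa * norm v.

Definition partial_BMP g Dg C pbar xbar : Prop :=
  exists kappa, BMP_modulus g Dg C pbar xbar kappa.
End System.

(* inf A <= inf B in [0, +infinity] (inf of the empty set = +infinity) *)
Definition inf_le (A B : R -> Prop) : Prop :=
  forall b, B b -> forall eps, 0 < eps -> exists a, A a /\ a <= b + eps.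

Definition C1_on {l d} (q : Vec l -> Vec d) (W : Vec l -> Prop) : Prop :=
  exists Dq : Vec l -> Mat d l,
    forall z, W z -> has_jac q z (Dq z) /\ mat_cont_at Dq z.

Definition subamenable {l} (C : Vec l -> Prop) (zbar : Vec l) : Prop :=
  C zbar /\
  exists (W : Vec l -> Prop) (d : nat) (q : Vec l -> Vec d) (Q : Vec d -> Prop),
    openV W /\ W zbar /\ C1_on q W /\ closedV Q /\ convexV Q /\
    (forall z, W z -> (C z <-> Q (q z))) /\
    (* metric subregularity of z |-> q(z) - Q (defined on W) at (zbar, 0):
       dist(z; F^-1(0)) <= kappa * dist(0; q(z) - Q) = kappa * dist(q(z); Q) *)
    (exists kappa delta, 0 <= kappa /\ 0 < delta /\
       forall z, W z -> norm (vsub z zbar) < delta ->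
         dist_le_scaled z (fun w => W w /\ Q (q w)) kappa (q z) Q).

(* Main.v *)
Require Import Defs.
From Stdlib Require Import Reals Lra Lia.
From Stdlib Require Import FunctionalExtensionality IndefiniteDescription Classical.
Open Scope R_scope.

(* Robinson stability with modulus kappa makes the solution set satisfy
   dist(y; Gamma(p)) <= kappa dist(g(p,y); C).  Hence a regular normal v to
   Gamma(p) at x makes x a local minimizer of
     - <v, y - x> + e |y - x| + (|v| + e) kappa |g(p,y) - c|   over c in C.
   Minimizing a smoothing of this penalty gives approximate multipliers of norm
   at most about kappa |v|, and compactness turns them into exact ones: the BMP
   holds with the same modulus.

   The same statement applied to q(z) in Q shows that normals to a subamenable C
   near the reference point come, with a uniform bound, from normals to a convex
   set, so that C is uniformly subsmooth:
   <lam, c - z> <= theta |lam| |c - z| for z, c in C nearby and lam normal at z.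
   For the converse, project x on Gamma(p) and apply the BMP to the proximal
   normal v = x - xt at the projection xt. *)

(** * Linear algebra and Euclidean norms *)

Definition vadd {n} (x y : Vec n) : Vec n := fun i => x i + y i.
Definition vscal {n} (t : R) (x : Vec n) : Vec n := fun i => t * x i.

Ltac vext := apply functional_extensionality; intro; unfold vsub, vadd, vscal; ring.

Lemma sumF_ext n (f h : Fin.t n -> R) : (forall i, f i = h i) -> sumF n f = sumF n h.
Proof.
  induction n; simpl; intros H; [reflexivity|].
  now rewrite H, (IHn _ (fun i => h (Fin.FS i))).
Qed.

Lemma sumF_plus n (f h : Fin.t n -> R) :
  sumF n (fun i => f i + h i) = sumF n f + sumF n h.
Proof. induction n; simpl; [ring|]. rewrite IHn; ring. Qed.

Lemma sumF_scal n t (f : Fin.t n -> R) : sumF n (fun i => t * f i) = t * sumF n f.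
Proof. induction n; simpl; [ring|]. rewrite IHn; ring. Qed.

Lemma sumF_const0 n : sumF n (fun _ => 0) = 0.
Proof. induction n; simpl; [|rewrite IHn]; ring. Qed.

Lemma sumF_le n (f h : Fin.t n -> R) :
  (forall i, f i <= h i) -> sumF n f <= sumF n h.
Proof.
  induction n; simpl; intros H; [lra|].
  specialize (IHn _ _ (fun i => H (Fin.FS i))). specialize (H Fin.F1). lra.
Qed.

Lemma sumF_swap m n (f : Fin.t m -> Fin.t n -> R) :
  sumF m (fun i => sumF n (f i)) = sumF n (fun j => sumF m (fun i => f i j)).
Proof.
  induction m; simpl; [now rewrite sumF_const0|].
  rewrite (IHm (fun i => f (Fin.FS i))), <- sumF_plus. reflexivity.
Qed.

Lemma dot_comm n (x y : Vec n) : dot x y = dot y x.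
Proof. apply sumF_ext; intro; ring. Qed.

Lemma dot_vadd_l n (x y z : Vec n) : dot (vadd x y) z = dot x z + dot y z.
Proof. unfold dot. rewrite <- sumF_plus. apply sumF_ext; intro; unfold vadd; ring. Qed.

Lemma dot_vscal_l n t (x z : Vec n) : dot (vscal t x) z = t * dot x z.
Proof. unfold dot. rewrite <- sumF_scal. apply sumF_ext; intro; unfold vscal; ring. Qed.

Lemma vsubE n (x y : Vec n) : vsub x y = vadd x (vscal (-1) y).
Proof. vext. Qed.

Lemma dot_vsub_l n (x y z : Vec n) : dot (vsub x y) z = dot x z - dot y z.
Proof. rewrite vsubE, dot_vadd_l, dot_vscal_l. ring. Qed.

Lemma dot_vadd_r n (x y z : Vec n) : dot z (vadd x y) = dot z x + dot z y.
Proof. rewrite !(dot_comm _ z). apply dot_vadd_l. Qed.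

Lemma dot_vscal_r n t (x z : Vec n) : dot z (vscal t x) = t * dot z x.
Proof. rewrite !(dot_comm _ z). apply dot_vscal_l. Qed.

Lemma dot_vsub_r n (x y z : Vec n) : dot z (vsub x y) = dot z x - dot z y.
Proof. rewrite !(dot_comm _ z). apply dot_vsub_l. Qed.

Lemma dot_nonneg n (x : Vec n) : 0 <= dot x x.
Proof.
  rewrite <- (sumF_const0 n). apply sumF_le; intro i. apply Rle_0_sqr.
Qed.

Lemma norm_nonneg n (x : Vec n) : 0 <= norm x.
Proof. apply sqrt_pos. Qed.

Lemma norm_sq n (x : Vec n) : norm x * norm x = dot x x.
Proof. apply sqrt_sqrt, dot_nonneg. Qed.

Lemma norm_le_of_sq n (x : Vec n) a : 0 <= a -> dot x x <= a * a -> norm x <= a.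
Proof.
  intros Ha H. pose proof (norm_nonneg n x). rewrite <- norm_sq in H. nra.
Qed.

(** Expanding [| |y| x - |x| y |^2 >= 0] gives [|x| |y| <x, y> <= |x|^2 |y|^2], which can be divided
    by [|x| |y|] when that product is positive. *)
Lemma cauchy_schwarz n (x y : Vec n) : dot x y <= norm x * norm y.
Proof.
  pose proof (norm_nonneg n x) as Hx. pose proof (norm_nonneg n y) as Hy.
  pose proof (norm_sq n x) as Hxx. pose proof (norm_sq n y) as Hyy.
  pose proof (dot_nonneg n (vsub (vscal (norm y) x) (vscal (norm x) y))) as H.
  rewrite dot_vsub_l, !dot_vsub_r, !dot_vscal_l, !dot_vscal_r, <- Hxx, <- Hyy,
    (dot_comm _ y x) in H.
  destruct (Rle_lt_dec (norm x * norm y) 0) as [H0|H0].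
  (* If one of the norms vanishes, say [|y| = 0], then [|x + t y|^2 = |x|^2 + 2 t <x, y>] would be
     negative for a very negative [t] unless [<x, y> <= 0]. *)
  - assert (Hd : forall t, 0 <= norm x * norm x + 2 * t * dot x y + t * t * (norm y * norm y)).
    { intro t. pose proof (dot_nonneg n (vadd x (vscal t y))) as Ht.
      rewrite dot_vadd_l, !dot_vadd_r, !dot_vscal_l, !dot_vscal_r, <- Hxx, <- Hyy,
        (dot_comm _ y x) in Ht. lra. }
    destruct (Rle_lt_dec (dot x y) 0); [nra|].
    assert (Hz : norm x = 0 \/ norm y = 0) by (apply Rmult_integral; nra).
    assert (Hd' : forall t, 0 <= norm y * norm y + 2 * t * dot x y + t * t * (norm x * norm x)).
    { intro t. pose proof (dot_nonneg n (vadd y (vscal t x))) as Ht.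
      rewrite dot_vadd_l, !dot_vadd_r, !dot_vscal_l, !dot_vscal_r, <- Hxx, <- Hyy,
        (dot_comm _ y x) in Ht. lra. }
    exfalso. destruct Hz as [Hz|Hz]; rewrite Hz in *.
    + specialize (Hd' (- (norm y * norm y + 1) / (2 * dot x y))).
      replace (2 * (- (norm y * norm y + 1) / (2 * dot x y)) * dot x y)
        with (- (norm y * norm y + 1)) in Hd' by (field; lra). lra.
    + specialize (Hd (- (norm x * norm x + 1) / (2 * dot x y))).
      replace (2 * (- (norm x * norm x + 1) / (2 * dot x y)) * dot x y)
        with (- (norm x * norm x + 1)) in Hd by (field; lra). lra.
  - apply (Rmult_le_reg_l (norm x * norm y)); lra.
Qed.

Lemma norm_vadd n (x y : Vec n) : norm (vadd x y) <= norm x + norm y.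
Proof.
  pose proof (norm_nonneg n x). pose proof (norm_nonneg n y).
  apply norm_le_of_sq; [lra|].
  rewrite dot_vadd_l, !dot_vadd_r, <- !norm_sq, (dot_comm _ y x).
  pose proof (cauchy_schwarz n x y). nra.
Qed.

Lemma norm_vscal n t (x : Vec n) : norm (vscal t x) = Rabs t * norm x.
Proof.
  unfold norm. rewrite dot_vscal_l, dot_vscal_r, <- Rmult_assoc, sqrt_mult_alt.
  - now rewrite <- sqrt_Rsqr_abs.
  - apply Rle_0_sqr.
Qed.

Lemma norm_vopp n (x : Vec n) : norm (vscal (-1) x) = norm x.
Proof. rewrite norm_vscal, Rabs_left; lra. Qed.

Lemma norm_sub_sym n (x y : Vec n) : norm (vsub x y) = norm (vsub y x).
Proof.
  replace (vsub x y) with (vscal (-1) (vsub y x)) by vext.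
  apply norm_vopp.
Qed.

Lemma norm_triangle n (y x z : Vec n) :
  norm (vsub x z) <= norm (vsub x y) + norm (vsub y z).
Proof.
  replace (vsub x z) with (vadd (vsub x y) (vsub y z)) by vext. apply norm_vadd.
Qed.

Lemma norm_vsub_le n (x y : Vec n) : norm x <= norm y + norm (vsub x y).
Proof.
  replace x with (vadd y (vsub x y)) at 1 by vext. apply norm_vadd.
Qed.

Lemma norm_vsub_self n (x : Vec n) : norm (vsub x x) = 0.
Proof.
  replace (vsub x x) with (vscal 0 x) by vext. rewrite norm_vscal, Rabs_R0. ring.
Qed.

Lemma cauchy_schwarz_neg n (x y : Vec n) : - (norm x * norm y) <= dot x y.
Proof.
  pose proof (cauchy_schwarz n (vscal (-1) x) y) as H.
  rewrite dot_vscal_l, norm_vopp in H. lra.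
Qed.

Lemma coord_le_norm n (x : Vec n) i : Rabs (x i) <= norm x.
Proof.
  apply Rabs_le.
  assert (H : x i * x i <= norm x * norm x).
  { rewrite norm_sq. unfold dot. induction i as [m|m i IH]; simpl.
    - pose proof (dot_nonneg m (fun j => x (Fin.FS j))). unfold dot in *. lra.
    - specialize (IH (fun j => x (Fin.FS j))). simpl in IH.
      pose proof (Rle_0_sqr (x Fin.F1)). unfold Rsqr in *. lra. }
  pose proof (norm_nonneg n x). split; nra.
Qed.

Lemma eq_of_dist0 n (x y : Vec n) :
  (forall eps, 0 < eps -> norm (vsub x y) <= eps) -> x = y.
Proof.
  intros H. apply functional_extensionality; intro i.
  destruct (Req_dec (x i) (y i)) as [|Hne]; [assumption|exfalso].
  assert (Hp : 0 < Rabs (x i - y i)) by (apply Rabs_pos_lt; lra).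
  specialize (H (Rabs (x i - y i) / 2) ltac:(lra)).
  pose proof (coord_le_norm n (vsub x y) i). unfold vsub in *. lra.
Qed.

Lemma dot_matvec l n (J : Mat l n) lam v : dot lam (matvec J v) = dot (matTvec J lam) v.
Proof.
  unfold dot, matvec, matTvec.
  rewrite (sumF_ext _ _ (fun i => sumF n (fun j => lam i * (J i j * v j))))
    by (intro; now rewrite sumF_scal).
  rewrite sumF_swap. apply sumF_ext; intro j.
  rewrite (Rmult_comm _ (v j)), <- sumF_scal. apply sumF_ext; intro; ring.
Qed.

Lemma matvec_vscal l n (J : Mat l n) t v : matvec J (vscal t v) = vscal t (matvec J v).
Proof.
  apply functional_extensionality; intro i. unfold matvec, vscal.
  rewrite <- sumF_scal. apply sumF_ext; intro; ring.
Qed.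

Lemma matTvec_matsub l n (A B : Mat l n) lam :
  matTvec (matsub A B) lam = vsub (matTvec A lam) (matTvec B lam).
Proof.
  rewrite vsubE. apply functional_extensionality; intro i.
  unfold matTvec, matsub, vadd, vscal.
  rewrite <- sumF_scal, <- sumF_plus. apply sumF_ext; intro; ring.
Qed.

Lemma matvec_matsub l n (A B : Mat l n) v :
  matvec (matsub A B) v = vsub (matvec A v) (matvec B v).
Proof.
  rewrite vsubE. apply functional_extensionality; intro i.
  unfold matvec, matsub, vadd, vscal.
  rewrite <- sumF_scal, <- sumF_plus. apply sumF_ext; intro; ring.
Qed.

Lemma matTvec_vsub l n (A : Mat l n) x y :
  matTvec A (vsub x y) = vsub (matTvec A x) (matTvec A y).
Proof.
  rewrite (vsubE n). apply functional_extensionality; intro i.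
  unfold matTvec, vsub, vadd, vscal.
  rewrite <- sumF_scal, <- sumF_plus. apply sumF_ext; intro; ring.
Qed.

Lemma matnorm_nonneg l n (A : Mat l n) : 0 <= matnorm A.
Proof. apply sqrt_pos. Qed.

Lemma norm_matvec l n (A : Mat l n) v : norm (matvec A v) <= matnorm A * norm v.
Proof.
  pose proof (matnorm_nonneg l n A). pose proof (norm_nonneg n v).
  apply norm_le_of_sq; [nra|].
  replace (matnorm A * norm v * (matnorm A * norm v))
    with (norm v * norm v * (matnorm A * matnorm A)) by ring.
  unfold matnorm. rewrite sqrt_sqrt.
  2: { rewrite <- (sumF_const0 l). apply sumF_le; intro i. apply (dot_nonneg n (A i)). }
  rewrite <- sumF_scal. apply sumF_le; intro i.
  change (sumF n (fun j => A i j * A i j)) with (dot (A i) (A i)).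
  change (matvec A v i) with (dot (A i) v). rewrite <- (norm_sq n (A i)).
  pose proof (cauchy_schwarz n (A i) v). pose proof (cauchy_schwarz_neg n (A i) v).
  pose proof (norm_nonneg n (A i)). nra.
Qed.

(** By duality: [|A^T lam|^2 = <lam, A (A^T lam)>], to which [norm_matvec] applies. *)
Lemma norm_matTvec l n (A : Mat l n) lam : norm (matTvec A lam) <= matnorm A * norm lam.
Proof.
  pose proof (norm_nonneg n (matTvec A lam)) as H0.
  destruct (Req_dec (norm (matTvec A lam)) 0) as [E|E].
  { rewrite E. pose proof (matnorm_nonneg l n A). pose proof (norm_nonneg l lam). nra. }
  apply (Rmult_le_reg_l (norm (matTvec A lam))); [lra|].
  rewrite norm_sq, <- dot_matvec.
  pose proof (cauchy_schwarz l lam (matvec A (matTvec A lam))).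
  pose proof (norm_matvec l n A (matTvec A lam)). pose proof (norm_nonneg l lam). nra.
Qed.

Lemma matnorm_vsub_le l n (A B : Mat l n) v :
  norm (matvec A v) <= (matnorm B + matnorm (matsub A B)) * norm v.
Proof.
  pose proof (norm_vsub_le l (matvec A v) (matvec B v)) as H.
  rewrite <- matvec_matsub in H.
  pose proof (norm_matvec l n (matsub A B) v). pose proof (norm_matvec l n B v). lra.
Qed.

Lemma matnorm_matsub_sym l n (A B : Mat l n) : matnorm (matsub A B) = matnorm (matsub B A).
Proof.
  unfold matnorm, matsub. f_equal. apply sumF_ext; intro i. apply sumF_ext; intro j. ring.
Qed.

(** * Subsequences, compactness and existence of minimizers *)

Definition extraction (phi : nat -> nat) := forall k, (phi k < phi (S k))%nat.

Lemma extraction_ge phi : extraction phi -> forall k, (k <= phi k)%nat.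
Proof. intros H k. induction k; [lia|]. specialize (H k). lia. Qed.

Lemma extraction_mono phi : extraction phi -> forall j k, (j < k)%nat -> (phi j < phi k)%nat.
Proof.
  intros H j k Hjk. induction Hjk as [|k _ IH]; [apply H|]. specialize (H k). lia.
Qed.

Lemma extraction_comp phi psi :
  extraction phi -> extraction psi -> extraction (fun k => phi (psi k)).
Proof. intros H1 H2 k. apply extraction_mono; auto. Qed.

Lemma Un_cv_extraction u a phi : extraction phi -> Un_cv u a -> Un_cv (fun k => u (phi k)) a.
Proof.
  intros Hphi H eps He. destruct (H eps He) as [N HN]. exists N. intros k Hk.
  apply HN. pose proof (extraction_ge phi Hphi k). lia.
Qed.

Lemma seq_conv_extraction n (u : nat -> Vec n) x phi :
  extraction phi -> seq_conv u x -> seq_conv (fun k => u (phi k)) x.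
Proof.
  intros Hphi H eps He. destruct (H eps He) as [N HN]. exists N. intros k Hk.
  apply HN. pose proof (extraction_ge phi Hphi k). lia.
Qed.

Lemma inv_nat_pos k : 0 < / INR (S k).
Proof. apply Rinv_0_lt_compat, lt_0_INR. lia. Qed.

Lemma inv_nat_small eps : 0 < eps -> exists N, forall k, (N <= k)%nat -> / INR (S k) < eps.
Proof.
  intros He. destruct (archimed_cor1 eps He) as [N [HN HN0]]. exists N. intros k Hk.
  apply Rle_lt_trans with (2 := HN). apply Rinv_le_contravar.
  - now apply lt_0_INR.
  - apply le_INR. lia.
Qed.

Lemma bounded_extraction_R (u : nat -> R) M :
  (forall k, Rabs (u k) <= M) -> exists phi a, extraction phi /\ Un_cv (fun k => u (phi k)) a.
Proof.
  intros HM.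
  destruct (Bolzano_Weierstrass u (fun c => - M <= c <= M)) as [a Ha].
  { apply compact_P3. }
  { intro k. pose proof (HM k). pose proof (Rle_abs (u k)).
    pose proof (Rle_abs (- u k)) as Hn. rewrite Rabs_Ropp in Hn. lra. }
  (* [Bolzano_Weierstrass] gives a cluster value only. An index beyond any [N] and within [1/(k+1)]
     of [a] is chosen for each pair [(k, N)]; feeding [S (phi j)] as [N] makes [phi] strictly
     increasing. *)
  assert (Hc : forall kN : nat * nat, exists j, (snd kN <= j)%nat /\
              Rabs (u j - a) < / INR (S (fst kN))).
  { intros [k N]. simpl.
    destruct (Ha (disc a (mkposreal _ (inv_nat_pos k))) N) as [j Hj].
    { exists (mkposreal _ (inv_nat_pos k)). intros y Hy; exact Hy. }
    exists j. exact Hj. }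
  apply functional_choice in Hc. destruct Hc as [ch Hch].
  pose (phi := fix phi k := match k with
          | O => ch (O, O) | S j => ch (S j, S (phi j)) end).
  exists phi, a. split.
  - intro k. change (phi (S k)) with (ch (S k, S (phi k))).
    destruct (Hch (S k, S (phi k))) as [H _]. simpl in H. lia.
  - intros eps He. destruct (inv_nat_small eps He) as [N HN]. exists N. intros k Hk.
    apply Rlt_trans with (2 := HN k Hk).
    destruct k; [apply (Hch (O, O))|apply (Hch (S k, S (phi k)))].
Qed.

(** Induction on the dimension: a subsequence for the tail coordinates, then a further one for the
    first coordinate. *)
Lemma bounded_extraction n (u : nat -> Vec n) M :
  (forall k, norm (u k) <= M) -> exists phi x, extraction phi /\ seq_conv (fun k => u (phi k)) x.
Proof.
  revert u M. induction n as [|n IH]; intros u M HM.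
  { exists (fun k => k), (u O). split; [intro; lia|]. intros eps He. exists O. intros k _.
    unfold norm, dot; simpl. now rewrite sqrt_0. }
  destruct (IH (fun k i => u k (Fin.FS i)) M) as [phi [y [Hphi Hy]]].
  { intro k. apply Rle_trans with (2 := HM k). apply sqrt_le_1_alt.
    unfold dot; simpl. pose proof (Rle_0_sqr (u k Fin.F1)). unfold Rsqr in *. lra. }
  destruct (bounded_extraction_R (fun k => u (phi k) Fin.F1) M) as [psi [a [Hpsi Ha]]].
  { intro k. apply Rle_trans with (2 := HM (phi k)). apply coord_le_norm. }
  exists (fun k => phi (psi k)), (fun i => Fin.caseS' i (fun _ => R) a y).
  split; [now apply extraction_comp|].
  apply (seq_conv_extraction _ _ _ psi Hpsi) in Hy.
  intros eps He. destruct (Hy (eps / 2) ltac:(lra)) as [N1 HN1].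
  destruct (Ha (eps / 2) ltac:(lra)) as [N2 HN2].
  exists (Nat.max N1 N2). intros k Hk.
  specialize (HN1 k ltac:(lia)). specialize (HN2 k ltac:(lia)).
  unfold Rdist in HN2. apply Rabs_def2 in HN2.
  set (z := vsub _ y) in HN1. pose proof (norm_nonneg _ z) as Hz.
  pose proof (norm_sq _ z) as Hzz.
  set (w := vsub _ _).
  assert (Hw : dot w w = (u (phi (psi k)) Fin.F1 - a) * (u (phi (psi k)) Fin.F1 - a) + dot z z)
    by reflexivity.
  pose proof (norm_nonneg _ w). rewrite <- norm_sq, <- Hzz in Hw. nra.
Qed.

Lemma seq_conv_bounded n (u : nat -> Vec n) x : seq_conv u x ->
  exists N, forall k, (N <= k)%nat -> norm (u k) <= norm x + 1.
Proof.
  intros H. destruct (H 1 Rlt_0_1) as [N HN]. exists N. intros k Hk.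
  specialize (HN k Hk). pose proof (norm_vsub_le _ (u k) x). lra.
Qed.

(* Cluster values replace subsequences, so that the same statement serves for
   functions of one vector and of a pair of vectors. *)
Lemma exists_argmin (X : Type) (K : X -> Prop) (F : X -> R) :
  (exists x, K x) ->
  (forall u, (forall k, K (u k)) -> exists x, K x /\
     forall eps N, 0 < eps -> exists k, (N <= k)%nat /\ F x < F (u k) + eps) ->
  exists x, K x /\ forall y, K y -> F x <= F y.
Proof.
  intros [x0 Hx0] Hcomp.
  pose (E := fun t => exists x, K x /\ t = - F x).
  assert (HE : bound E).
  (* Were [F] unbounded below on [K], a sequence with [F (u k) < - k] would contradict its own
     cluster value. So [- m] below is the infimum of [F], and a minimizing sequence exists. *)
  { apply NNPP. intro Hb.
    assert (Hu : forall k : nat, exists x, K x /\ F x < - INR k).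
    { intro k. apply NNPP. intro Hk. apply Hb. exists (INR k). intros t [x [Hx ->]].
      apply Rnot_lt_le. intro Hlt. apply Hk. exists x. split; [assumption|lra]. }
    apply functional_choice in Hu. destruct Hu as [u Hu].
    destruct (Hcomp u (fun k => proj1 (Hu k))) as [x [_ Hx]].
    destruct (INR_unbounded (1 - F x)) as [N HN].
    destruct (Hx 1 N Rlt_0_1) as [k [Hk Hlt]].
    apply le_INR in Hk. destruct (Hu k). lra. }
  destruct (completeness E HE) as [m [Hm1 Hm2]].
  { exists (- F x0), x0. auto. }
  assert (Hu : forall k : nat, exists x, K x /\ F x < - m + / INR (S k)).
  { intro k. apply NNPP. intro Hk. pose proof (inv_nat_pos k).
    assert (m <= m - / INR (S k)); [|lra].
    apply Hm2. intros t [x [Hx ->]].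
    apply Rnot_lt_le. intro Hlt. apply Hk. exists x. split; [assumption|lra]. }
  apply functional_choice in Hu. destruct Hu as [u Hu].
  destruct (Hcomp u (fun k => proj1 (Hu k))) as [x [HKx Hx]].
  exists x. split; [assumption|]. intros y Hy.
  assert (- F y <= m) by (apply Hm1; exists y; auto).
  apply Rle_trans with (- m); [|lra].
  apply le_epsilon. intros eps He.
  destruct (inv_nat_small (eps / 2) ltac:(lra)) as [N HN].
  destruct (Hx (eps / 2) N ltac:(lra)) as [k [Hk Hlt]].
  specialize (HN k Hk). destruct (Hu k). lra.
Qed.

(** * Limits of norms and inner products *)

Lemma seq_conv_const n (x : Vec n) : seq_conv (fun _ => x) x.
Proof. intros eps He. exists O. intros. now rewrite norm_vsub_self. Qed.

Lemma seq_conv_vsub n (u w : nat -> Vec n) x y :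
  seq_conv u x -> seq_conv w y -> seq_conv (fun k => vsub (u k) (w k)) (vsub x y).
Proof.
  intros Hu Hw eps He. destruct (Hu (eps / 2) ltac:(lra)) as [N1 H1].
  destruct (Hw (eps / 2) ltac:(lra)) as [N2 H2].
  exists (Nat.max N1 N2). intros k Hk.
  specialize (H1 k ltac:(lia)). specialize (H2 k ltac:(lia)).
  replace (vsub _ _) with (vsub (vsub (u k) x) (vsub (w k) y)) by vext.
  pose proof (norm_vadd _ (vsub (u k) x) (vscal (-1) (vsub (w k) y))) as H.
  rewrite <- vsubE, norm_vopp in H. lra.
Qed.

Lemma Un_cv_const a : Un_cv (fun _ => a) a.
Proof. intros eps He. exists O. intros. now rewrite Rdist_eq. Qed.

Lemma Un_cv_norm n (u : nat -> Vec n) x : seq_conv u x -> Un_cv (fun k => norm (u k)) (norm x).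
Proof.
  intros H eps He. destruct (H eps He) as [N HN]. exists N. intros k Hk.
  specialize (HN k Hk). pose proof (norm_vsub_le _ (u k) x).
  pose proof (norm_vsub_le _ x (u k)) as H1. rewrite (norm_sub_sym _ x) in H1.
  apply Rabs_def1; lra.
Qed.

(** Polarization expresses the inner product through norms, whose limits are known. *)
Lemma Un_cv_dot n (u w : nat -> Vec n) x y :
  seq_conv u x -> seq_conv w y -> Un_cv (fun k => dot (u k) (w k)) (dot x y).
Proof.
  intros Hu Hw.
  assert (E : forall a b : Vec n, dot a b =
    (norm a * norm a + norm b * norm b - norm (vsub a b) * norm (vsub a b)) * / 2).
  { intros a b. rewrite !norm_sq, dot_vsub_l, !dot_vsub_r, (dot_comm _ b a). field. }
  rewrite E. apply Un_cv_ext with (un := fun k =>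
    (norm (u k) * norm (u k) + norm (w k) * norm (w k)
     - norm (vsub (u k) (w k)) * norm (vsub (u k) (w k))) * / 2); [intro; now rewrite E|].
  apply (CV_mult _ (fun _ => / 2)); [|apply Un_cv_const].
  apply CV_minus; [apply CV_plus|]; apply CV_mult;
    apply Un_cv_norm; try assumption; now apply seq_conv_vsub.
Qed.

Lemma seq_conv_norm_le n (u : nat -> Vec n) x b :
  seq_conv u x -> (forall k, norm (u k) <= b) -> norm x <= b.
Proof.
  intros Hu Hb. apply le_epsilon. intros eps He. destruct (Hu eps He) as [N HN].
  specialize (HN N (le_n N)). specialize (Hb N).
  pose proof (norm_vsub_le _ x (u N)) as H. rewrite norm_sub_sym in H. lra.
Qed.

(** * Differentiable maps and the mean value theorem *)

Lemma has_jac_lipschitz n l (f : Vec n -> Vec l) x J : has_jac f x J ->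
  exists d, 0 < d /\ forall y, norm (vsub y x) < d ->
    norm (vsub (f y) (f x)) <= (matnorm J + 1) * norm (vsub y x).
Proof.
  intros H. destruct (H 1 Rlt_0_1) as [d [Hd HJ]]. exists d. split; [assumption|].
  intros y Hy. specialize (HJ y Hy).
  pose proof (norm_vsub_le _ (vsub (f y) (f x)) (matvec J (vsub y x))).
  pose proof (norm_matvec _ _ J (vsub y x)). lra.
Qed.

Lemma has_jac_continuous n l (f : Vec n -> Vec l) x J : has_jac f x J ->
  forall eps, 0 < eps -> exists d, 0 < d /\ forall y, norm (vsub y x) < d ->
    norm (vsub (f y) (f x)) < eps.
Proof.
  intros H eps He. destruct (has_jac_lipschitz _ _ _ _ _ H) as [d [Hd HL]].
  pose proof (matnorm_nonneg _ _ J).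
  exists (Rmin d (eps / (matnorm J + 1))). split.
  { apply Rmin_glb_lt; [assumption|]. apply Rdiv_lt_0_compat; lra. }
  intros y Hy. apply Rmin_Rgt_l in Hy. destruct Hy as [Hy1 Hy2].
  apply Rle_lt_trans with (1 := HL y Hy1).
  apply (Rmult_lt_compat_l (matnorm J + 1)) in Hy2; [|lra].
  replace ((matnorm J + 1) * (eps / (matnorm J + 1))) with eps in Hy2 by (field; lra).
  exact Hy2.
Qed.

Lemma has_jac_seq_conv n l (f : Vec n -> Vec l) x J u :
  has_jac f x J -> seq_conv u x -> seq_conv (fun k => f (u k)) (f x).
Proof.
  intros H Hu eps He. destruct (has_jac_continuous _ _ _ _ _ H eps He) as [d [Hd Hf]].
  destruct (Hu d Hd) as [N HN]. exists N. auto.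
Qed.

(** Pairing with a fixed [w] turns [f] along the segment from [x] to [y] into a real function of one
    variable; the intermediate point depends on [w]. *)
Lemma mean_value n l (f : Vec n -> Vec l) Df a r x y (w : Vec l) :
  (forall z, norm (vsub z a) < r -> has_jac f z (Df z)) ->
  norm (vsub x a) < r -> norm (vsub y a) < r ->
  exists z, norm (vsub z a) < r /\
    dot w (vsub (f y) (f x)) = dot w (matvec (Df z) (vsub y x)).
Proof.
  intros Hf Hx Hy. set (h := vsub y x).
  pose (s := fun t : R => vadd x (vscal t h)).
  assert (Hs : forall t, 0 <= t <= 1 -> norm (vsub (s t) a) < r).
  { intros t Ht.
    replace (vsub (s t) a) with (vadd (vscal (1 - t) (vsub x a)) (vscal t (vsub y a)))
      by (unfold s, h; vext).
    pose proof (norm_vadd _ (vscal (1 - t) (vsub x a)) (vscal t (vsub y a))) as H.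
    rewrite !norm_vscal, !Rabs_pos_eq in H by lra.
    (* The strict inequality comes from whichever of the weights [1 - t] and [t] is positive. *)
    destruct (Req_dec t 0); nra. }
  destruct (MVT_cor2 (fun t => dot w (f (s t))) (fun t => dot w (matvec (Df (s t)) h)) 0 1 Rlt_0_1)
    as [t [Ht Ht01]].
  - intros t Ht eps He. pose proof (norm_nonneg _ w). pose proof (norm_nonneg _ h).
    assert (Hwh : 0 < norm w * norm h + 1) by nra.
    (* With this tolerance the pairing of the remainder with [w], divided by [b], stays below [eps];
       the added 1 covers [|w| |h| = 0]. *)
    destruct (Hf (s t) (Hs t Ht) (eps / (norm w * norm h + 1))) as [d [Hd HJ]].
    { apply Rdiv_lt_0_compat; lra. }
    assert (Hd' : 0 < d / (norm h + 1)) by (apply Rdiv_lt_0_compat; lra).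
    exists (mkposreal _ Hd'). simpl. intros b Hb0 Hb.
    assert (Hbp : 0 < Rabs b) by now apply Rabs_pos_lt.
    specialize (HJ (s (t + b))).
    replace (vsub (s (t + b)) (s t)) with (vscal b h) in HJ by (unfold s; vext).
    rewrite norm_vscal, matvec_vscal in HJ.
    assert (Hbh : Rabs b * norm h < d).
    { apply Rle_lt_trans with (Rabs b * (norm h + 1)); [nra|].
      apply (Rmult_lt_compat_r (norm h + 1)) in Hb; [|lra].
      replace (d / (norm h + 1) * (norm h + 1)) with d in Hb by (field; lra). lra. }
    specialize (HJ Hbh). set (e := vsub (vsub _ _) _) in HJ.
    replace ((dot w (f (s (t + b))) - dot w (f (s t))) / b - dot w (matvec (Df (s t)) h))
      with (dot w e / b)
      by (unfold e; rewrite !dot_vsub_r, dot_vscal_r; field; assumption).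
    unfold Rdiv. rewrite Rabs_mult, Rabs_inv.
    apply (Rmult_lt_reg_r (Rabs b)); [assumption|].
    rewrite Rmult_assoc, Rinv_l, Rmult_1_r by lra.
    assert (Habs : Rabs (dot w e) <= norm w * norm e).
    { apply Rabs_le. split; [apply cauchy_schwarz_neg|apply cauchy_schwarz]. }
    apply Rle_lt_trans with (1 := Habs).
    apply Rle_lt_trans with (norm w * (eps / (norm w * norm h + 1) * (Rabs b * norm h))).
    { now apply Rmult_le_compat_l. }
    replace (norm w * (eps / (norm w * norm h + 1) * (Rabs b * norm h)))
      with (eps * Rabs b * (1 - / (norm w * norm h + 1))) by (field; lra).
    assert (0 < / (norm w * norm h + 1)) by now apply Rinv_0_lt_compat.
    assert (0 < eps * Rabs b) by nra. nra.
  - exists (s t). split; [apply Hs; lra|].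
    rewrite dot_vsub_r.
    replace (s 1) with y in Ht by (unfold s, h; vext).
    replace (s 0) with x in Ht by (unfold s; vext). lra.
Qed.

(** * First-order conditions and the multiplier rule *)

(** A quadratic remainder is [o(|y - x|)]. Both the penalty minimizer and the metric projection
    produce their normals in this form. *)
Lemma reg_normal_of_quadratic n (S : Vec n -> Prop) x v A r :
  S x -> 0 < r ->
  (forall y, S y -> norm (vsub y x) < r ->
     dot v (vsub y x) <= A * (norm (vsub y x) * norm (vsub y x))) ->
  reg_normal S x v.
Proof.
  intros HS Hr H. split; [assumption|]. intros eps He.
  assert (HA : 0 < Rabs A + 1) by (pose proof (Rabs_pos A); lra).
  exists (Rmin r (eps / (Rabs A + 1))). split.
  { apply Rmin_glb_lt; [assumption|]. now apply Rdiv_lt_0_compat. }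
  intros y Hy Hd. apply Rmin_Rgt_l in Hd. destruct Hd as [H1 H2].
  apply Rle_trans with (1 := H y Hy H1).
  apply (Rmult_lt_compat_l (Rabs A + 1)) in H2; [|lra].
  replace ((Rabs A + 1) * (eps / (Rabs A + 1))) with eps in H2 by (field; lra).
  pose proof (norm_nonneg _ (vsub y x)). pose proof (Rle_abs A). nra.
Qed.

(** Testing with a step of length [d / 2] in the direction [- u] gives [|u| <= b + eps]. *)
Lemma first_order_bound n (u x : Vec n) b :
  0 <= b ->
  (forall eps, 0 < eps -> exists d, 0 < d /\ forall y, norm (vsub y x) < d ->
     0 <= dot u (vsub y x) + (b + eps) * norm (vsub y x)) ->
  norm u <= b.
Proof.
  intros Hb H. pose proof (norm_nonneg _ u) as Hu.
  apply le_epsilon. intros eps He. destruct (H eps He) as [d [Hd Hy]].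
  destruct (Req_dec (norm u) 0) as [E|E]; [lra|].
  set (t := d / (2 * norm u)).
  assert (Ht : 0 < t) by (apply Rdiv_lt_0_compat; lra).
  specialize (Hy (vadd x (vscal (- t) u))).
  replace (vsub (vadd x (vscal (- t) u)) x) with (vscal (- t) u) in Hy by vext.
  rewrite norm_vscal, Rabs_Ropp, Rabs_pos_eq, dot_vscal_r, <- norm_sq in Hy by lra.
  replace (t * norm u) with (d / 2) in Hy by (unfold t; field; lra).
  specialize (Hy ltac:(lra)).
  replace (- t * (norm u * norm u)) with (- (d / 2) * norm u) in Hy by (unfold t; field; lra).
  nra.
Qed.

(* Replaces the smoothed norm by a quadratic majorant touching it at the
   minimizer, so that stationarity needs no derivative of sqrt. *)
Lemma sqrt_tangent a b : 0 < a -> 0 <= b ->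
  sqrt b <= sqrt a + (b - a) / (2 * sqrt a).
Proof.
  intros Ha Hb. pose proof (sqrt_lt_R0 a Ha). pose proof (sqrt_sqrt a ltac:(lra)) as Ea.
  pose proof (sqrt_sqrt b Hb) as Eb.
  apply (Rmult_le_reg_l (2 * sqrt a)); [lra|].
  replace (2 * sqrt a * (sqrt a + (b - a) / (2 * sqrt a)))
    with (2 * (sqrt a * sqrt a) + (b - a)) by (field; lra).
  rewrite Ea. pose proof (Rle_0_sqr (sqrt a - sqrt b)) as Hsq. unfold Rsqr in Hsq. nra.
Qed.

(** Exact penalization. If [|y - x| <= kappa |f y - c|], Cauchy-Schwarz is enough. Otherwise some
    [s] in [S] lies about [kappa |f y - c|] away from [y], and the normal inequality at [s] is
    transferred to [y] at the cost [(|v| + e) |y - s|]. *)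
Lemma reg_normal_penalty n l (f : Vec n -> Vec l) (C : Vec l -> Prop) S x v kappa r e :
  0 <= kappa -> 0 < r -> 0 < e ->
  (forall y, norm (vsub y x) < r -> dist_le_scaled y S kappa (f y) C) ->
  reg_normal S x v ->
  exists rho, 0 < rho /\ forall y c, norm (vsub y x) < rho -> C c ->
    dot v (vsub y x) <= e * norm (vsub y x) + (norm v + e) * kappa * norm (vsub (f y) c).
Proof.
  intros Hk Hr He HS [HSx Hv]. destruct (Hv e He) as [d [Hd Hv']].
  (* The point [s] used below satisfies [|s - x| <= 2 |y - x| < d]. *)
  exists (Rmin r (d / 2)). split; [apply Rmin_glb_lt; lra|].
  intros y c Hy Hc. apply Rmin_Rgt_l in Hy. destruct Hy as [Hy1 Hy2].
  pose proof (norm_nonneg _ v). pose proof (norm_nonneg _ (vsub y x)).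
  set (N := norm (vsub (f y) c)). assert (HN : 0 <= N) by apply norm_nonneg.
  assert (HkN : 0 <= kappa * N) by nra.
  destruct (Rle_lt_dec (norm (vsub y x)) (kappa * N)) as [Hfar|Hnear].
  { pose proof (cauchy_schwarz _ v (vsub y x)). nra. }
  apply le_epsilon. intros t Ht.
  (* The first bound keeps [|y - s| <= |y - x|]; the second makes the slack cost at most [t]. *)
  set (tau := Rmin (norm (vsub y x) - kappa * N) (t / (norm v + e))).
  assert (Htau : 0 < tau).
  { apply Rmin_glb_lt; [lra|]. apply Rdiv_lt_0_compat; lra. }
  destruct (HS y Hy1 c Hc tau Htau) as [s [Hs Hys]]. fold N in Hys.
  assert (Ht1 : tau <= norm (vsub y x) - kappa * N) by apply Rmin_l.
  assert (Ht2 : (norm v + e) * tau <= t).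
  { apply Rle_trans with ((norm v + e) * (t / (norm v + e))); [|right; field; lra].
    apply Rmult_le_compat_l; [lra|apply Rmin_r]. }
  pose proof (norm_triangle _ y s x) as Htri. rewrite (norm_sub_sym _ s y) in Htri.
  specialize (Hv' s Hs ltac:(lra)).
  pose proof (cauchy_schwarz _ v (vsub y s)) as Hcs.
  replace (vsub y x) with (vadd (vsub y s) (vsub s x)) at 1 by vext.
  rewrite dot_vadd_r. nra.
Qed.

(** At a minimizer [(y, c)] of the smoothed penalty, stationarity in [c] over [C] yields the normal
    [lam'], and stationarity in [y] yields the approximate adjoint equation for [lam]. *)
Lemma approximate_multiplier n l (f : Vec n -> Vec l) Df (C : Vec l -> Prop) S x v kappa r eps :
  closedV C -> 0 <= kappa -> 0 < r -> 0 < eps ->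
  (forall y, norm (vsub y x) < r -> has_jac f y (Df y)) ->
  (forall y, norm (vsub y x) < r -> dist_le_scaled y S kappa (f y) C) ->
  C (f x) -> reg_normal S x v ->
  exists y c lam lam', norm (vsub y x) < eps /\ norm (vsub c (f x)) < eps /\
    reg_normal C c lam' /\ norm (vsub lam' lam) <= eps /\
    norm (vsub (matTvec (Df y) lam) v) <= eps /\ norm lam <= kappa * norm v + eps.
Proof.
  intros HC Hk Hr Heps HJ HS Hfx Hv.
  pose proof (norm_nonneg _ v) as Hv0.
  (* The adjoint equation will hold up to [2 e], and the norm of [lam] will exceed [kappa |v|] by at
     most [kappa e]. *)
  set (e := eps / (2 + kappa)).
  assert (He : 0 < e) by (apply Rdiv_lt_0_compat; lra).
  assert (Hee : 2 * e + kappa * e = eps) by (unfold e; field; lra).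
  assert (Hke : 0 <= kappa * e) by nra.
  destruct (reg_normal_penalty _ _ f C S x v kappa r e Hk Hr He HS Hv) as [rho [Hrho Hpen]].
  set (M := (norm v + e) * kappa) in *.
  assert (HM : 0 <= M) by (unfold M; nra).
  set (R0 := Rmin (Rmin rho r) eps / 2).
  assert (HR0 : 0 < Rmin (Rmin rho r) eps) by (repeat apply Rmin_glb_lt; lra).
  assert (HR : 0 < R0 /\ R0 < rho /\ R0 < r /\ R0 < eps).
  { pose proof (Rmin_l (Rmin rho r) eps). pose proof (Rmin_r (Rmin rho r) eps).
    pose proof (Rmin_l rho r). pose proof (Rmin_r rho r). unfold R0; lra. }
  clearbody R0. destruct HR as [HRp [HRrho [HRr HReps]]].
  (* The minimizer will satisfy [|c - f x| < m]: below 1, so that the constraint of [K] on [c] is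
     inactive, and at most [eps / 2], so that [lam'] is within [eps] of [lam]. *)
  set (m := Rmin 1 (eps / 2)).
  assert (Hm : 0 < m /\ m <= 1 /\ m <= eps / 2).
  { split; [apply Rmin_glb_lt; lra|split; [apply Rmin_l|apply Rmin_r]]. }
  clearbody m. destruct Hm as [Hm0 [Hm1 Hm2]].
  (* The smoothing parameter is chosen with [M delta < T], which forces [|y - x| < R0] and
     [|c - f x| < m] at the minimizer. *)
  set (T := Rmin (e * R0) (m * m)).
  assert (HT : 0 < T /\ T <= e * R0 /\ T <= m * m).
  { split; [apply Rmin_glb_lt; nra|split; [apply Rmin_l|apply Rmin_r]]. }
  clearbody T. destruct HT as [HT0 [HT1 HT2]].
  set (delta := T / (M + 1)).
  assert (Hdelta : 0 < delta) by (apply Rdiv_lt_0_compat; lra).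
  assert (HMd : M * delta < T).
  { assert (M * delta = T - delta) by (unfold delta; field; lra). lra. }
  assert (Hdd : 0 < delta * delta) by nra.
  (* One [e |y - x|] is absorbed by the penalty inequality; the other one and the square of
     [|c - f x|] localize the minimizer. *)
  pose (F := fun yc : Vec n * Vec l =>
    - dot v (vsub (fst yc) x) + 2 * e * norm (vsub (fst yc) x)
    + M * sqrt (norm (vsub (f (fst yc)) (snd yc)) * norm (vsub (f (fst yc)) (snd yc))
                + delta * delta)
    + norm (vsub (snd yc) (f x)) * norm (vsub (snd yc) (f x))).
  pose (K := fun yc : Vec n * Vec l =>
    norm (vsub (fst yc) x) <= R0 /\ C (snd yc) /\ norm (vsub (snd yc) (f x)) <= 1).
  destruct (exists_argmin _ K F) as [[y c] [[Hy [Hc Hc1]] Hmin]].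
  { exists (x, f x). unfold K; simpl. rewrite !norm_vsub_self. repeat split; [lra|assumption|lra]. }
  { intros u Hu.
    destruct (bounded_extraction _ (fun k => fst (u k)) (norm x + R0)) as [phi [y [Hphi Hy]]].
    { intro k. destruct (Hu k) as [H1 _]. pose proof (norm_vsub_le _ (fst (u k)) x). lra. }
    destruct (bounded_extraction _ (fun k => snd (u (phi k))) (norm (f x) + 1))
      as [psi [c [Hpsi Hc]]].
    { intro k. destruct (Hu (phi k)) as [_ [_ H1]].
      pose proof (norm_vsub_le _ (snd (u (phi k))) (f x)). lra. }
    apply (seq_conv_extraction _ _ _ psi Hpsi) in Hy.
    pose proof (extraction_comp _ _ Hphi Hpsi) as Hchi. simpl in *.
    assert (HyR : norm (vsub y x) <= R0).
    { eapply seq_conv_norm_le; [exact (seq_conv_vsub _ _ _ _ _ Hy (seq_conv_const _ x))|].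
      intro k. apply (Hu (phi (psi k))). }
    exists (y, c). split.
    { unfold K; simpl. split; [assumption|split].
      - apply (HC _ _ (fun k => proj1 (proj2 (Hu (phi (psi k))))) Hc).
      - eapply seq_conv_norm_le; [exact (seq_conv_vsub _ _ _ _ _ Hc (seq_conv_const _ (f x)))|].
        intro k. apply (Hu (phi (psi k))). }
    assert (Hcv : Un_cv (fun k => F (u (phi (psi k)))) (F (y, c))).
    { pose proof (seq_conv_vsub _ _ _ _ _ Hy (seq_conv_const _ x)) as Hyx.
      pose proof (seq_conv_vsub _ _ _ _ _ Hc (seq_conv_const _ (f x))) as Hcx.
      pose proof (has_jac_seq_conv _ _ f y (Df y) _ (HJ y ltac:(lra)) Hy) as Hfy.
      pose proof (Un_cv_norm _ _ _ (seq_conv_vsub _ _ _ _ _ Hfy Hc)) as Hfc.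
      apply CV_plus; [apply CV_plus; [apply CV_plus|]|].
      - apply (CV_opp (fun k => dot v (vsub (fst (u (phi (psi k)))) x))).
        apply (Un_cv_dot _ (fun _ => v) _ _ _ (seq_conv_const _ v) Hyx).
      - apply (CV_mult (fun _ => 2 * e)); [apply Un_cv_const|apply (Un_cv_norm _ _ _ Hyx)].
      - apply (CV_mult (fun _ => M)); [apply Un_cv_const|].
        apply (continuity_seq sqrt).
        { apply sqrt_continuity_pt. simpl.
          pose proof (norm_nonneg _ (vsub (f y) c)). nra. }
        apply (CV_plus (fun k => _ * _) (fun _ => delta * delta));
          [apply CV_mult; exact Hfc|apply Un_cv_const].
      - apply CV_mult; exact (Un_cv_norm _ _ _ Hcx). }
    intros eta N Heta. destruct (Hcv eta Heta) as [N' HN'].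
    exists (phi (psi (Nat.max N N'))). split.
    { pose proof (extraction_ge _ Hchi (Nat.max N N')). simpl in *. lia. }
    specialize (HN' (Nat.max N N') ltac:(lia)). apply Rabs_def2 in HN'. lra. }
  simpl in Hy, Hc, Hc1.
  set (s2 := norm (vsub (f y) c) * norm (vsub (f y) c) + delta * delta).
  assert (Hs2 : 0 < s2) by (unfold s2; pose proof (norm_nonneg _ (vsub (f y) c)); nra).
  set (s := sqrt s2).
  assert (Hs : 0 < s) by now apply sqrt_lt_R0.
  assert (Hss : s * s = s2) by (apply sqrt_sqrt; lra).
  assert (Hns : norm (vsub (f y) c) <= s).
  { pose proof (norm_nonneg _ (vsub (f y) c)). unfold s2 in Hss. nra. }
  (* Comparison with [(x, f x)], where [F] equals [M delta], combined with the penalty inequality at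
     [(y, c)]. *)
  assert (Hloc : e * norm (vsub y x) + norm (vsub c (f x)) * norm (vsub c (f x)) <= M * delta).
  { assert (HK : K (x, f x)).
    { unfold K; simpl. rewrite !norm_vsub_self. repeat split; [lra|assumption|lra]. }
    specialize (Hmin _ HK). unfold F in Hmin; simpl in Hmin. fold s2 s in Hmin.
    rewrite !norm_vsub_self, Rmult_0_l, Rplus_0_l, sqrt_square in Hmin by lra.
    replace (dot v (vsub x x)) with 0 in Hmin
      by (rewrite dot_vsub_r; ring).
    specialize (Hpen y c ltac:(lra) Hc). nra. }
  pose proof (norm_nonneg _ (vsub y x)). pose proof (norm_nonneg _ (vsub c (f x))).
  assert (HyR : norm (vsub y x) < R0) by nra.
  assert (Hcm : norm (vsub c (f x)) < m) by nra.
  (* [lam] is [M] times the gradient of the smoothed norm at [f y - c], so [|lam| <= M]; [lam']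
     subtracts the gradient of the square of [|c - f x|]. *)
  set (lam := vscal (M / s) (vsub (f y) c)).
  set (lam' := vsub lam (vscal 2 (vsub c (f x)))).
  assert (HMs : 0 <= M / s).
  { apply Rmult_le_pos; [assumption|]. left. now apply Rinv_0_lt_compat. }
  exists y, c, lam, lam'. split; [lra|]. split; [lra|]. split; [|split; [|split]].
  (* The tangent bound for the root contributes [M / s / 2] to the quadratic constant, and the
     squared distance contributes 1. The radius keeps [c'] in the unit ball around [f x]. *)
  - apply reg_normal_of_quadratic with (A := M / s / 2 + 1) (r := 1 - norm (vsub c (f x)));
      [assumption|lra|].
    intros c' Hc' Hd.
    assert (HK : K (y, c')).
    { unfold K; simpl. pose proof (norm_triangle _ c c' (f x)).
      split; [lra|split; [assumption|lra]]. }
    specialize (Hmin _ HK). unfold F in Hmin; simpl in Hmin. fold s2 s in Hmin.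
    set (b := norm (vsub (f y) c') * norm (vsub (f y) c') + delta * delta) in Hmin.
    assert (Hb0 : 0 <= b) by (unfold b; pose proof (norm_nonneg _ (vsub (f y) c')); nra).
    pose proof (sqrt_tangent s2 b Hs2 Hb0) as Htan. fold s in Htan.
    apply (Rmult_le_compat_l M) in Htan; [|assumption].
    replace (M * (s + (b - s2) / (2 * s))) with (M * s + M / s * ((b - s2) / 2)) in Htan
      by (field; lra).
    assert (Hb : b - s2 = norm (vsub c' c) * norm (vsub c' c) - 2 * dot (vsub (f y) c) (vsub c' c)).
    { unfold b, s2. rewrite !norm_sq.
      replace (vsub (f y) c') with (vsub (vsub (f y) c) (vsub c' c)) by vext.
      rewrite (dot_vsub_l _ (vsub (f y) c) (vsub c' c)), !(dot_vsub_r _ (vsub (f y) c)),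
        (dot_comm _ (vsub c' c) (vsub (f y) c)). ring. }
    assert (Hq : norm (vsub c' (f x)) * norm (vsub c' (f x)) =
                 norm (vsub c (f x)) * norm (vsub c (f x))
                 + 2 * dot (vsub c (f x)) (vsub c' c) + norm (vsub c' c) * norm (vsub c' c)).
    { rewrite !norm_sq.
      replace (vsub c' (f x)) with (vadd (vsub c (f x)) (vsub c' c)) by vext.
      rewrite dot_vadd_l, !dot_vadd_r, (dot_comm _ (vsub c' c) (vsub c (f x))). ring. }
    unfold lam', lam. rewrite dot_vsub_l, !dot_vscal_l. rewrite Hb in Htan. nra.
  - unfold lam'. replace (vsub (vsub lam (vscal 2 (vsub c (f x)))) lam)
      with (vscal (-1) (vscal 2 (vsub c (f x)))) by vext.
    rewrite norm_vopp, norm_vscal, Rabs_pos_eq by lra. lra.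
  - apply Rle_trans with (2 * e); [|lra].
    apply first_order_bound with (x := y); [lra|]. intros eta Heta.
    pose proof (norm_nonneg _ lam) as Hlam0. pose proof (matnorm_nonneg _ _ (Df y)) as HJ0.
    assert (HJy : has_jac f y (Df y)) by (apply HJ; lra).
    (* [eta1] bounds the linearization error of [f] paired with [lam]; [eta2] bounds the term in the
       square of [|f y' - f y|]. Each may cost [eta / 2] times [|y' - y|]. *)
    set (eta1 := eta / (2 * (norm lam + 1))).
    assert (Heta1 : 0 < eta1 /\ norm lam * eta1 <= eta / 2).
    { assert (0 < eta1) by (apply Rdiv_lt_0_compat; lra). split; [assumption|].
      assert ((norm lam + 1) * eta1 = eta / 2) by (unfold eta1; field; lra). nra. }
    set (B := M / s / 2 * (matnorm (Df y) + 1)).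
    assert (HB : 0 <= B) by (unfold B; apply Rmult_le_pos; lra).
    set (eta2 := eta / (2 * (B + 1))).
    assert (Heta2 : 0 < eta2 /\ B * eta2 <= eta / 2).
    { assert (0 < eta2) by (apply Rdiv_lt_0_compat; lra). split; [assumption|].
      assert ((B + 1) * eta2 = eta / 2) by (unfold eta2; field; lra). nra. }
    clearbody eta1 eta2. destruct Heta1 as [He1 He1']. destruct Heta2 as [He2 He2'].
    destruct (HJy eta1 He1) as [d1 [Hd1 HJ1]].
    destruct (has_jac_continuous _ _ _ _ _ HJy eta2 He2) as [d2 [Hd2 HJ2]].
    destruct (has_jac_lipschitz _ _ _ _ _ HJy) as [d3 [Hd3 HJ3]].
    exists (Rmin (Rmin d1 d2) (Rmin d3 (R0 - norm (vsub y x)))).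
    split; [repeat apply Rmin_glb_lt; lra|].
    intros y' Hy'. apply Rmin_Rgt_l in Hy'. destruct Hy' as [Hy'1 Hy'2].
    apply Rmin_Rgt_l in Hy'1. apply Rmin_Rgt_l in Hy'2.
    specialize (HJ1 y' ltac:(lra)). specialize (HJ2 y' ltac:(lra)).
    specialize (HJ3 y' ltac:(lra)).
    pose proof (norm_triangle _ y y' x) as Htri.
    assert (HK : K (y', c)) by (unfold K; simpl; split; [lra|split; [assumption|lra]]).
    specialize (Hmin _ HK). unfold F in Hmin; simpl in Hmin. fold s2 s in Hmin.
    set (b := norm (vsub (f y') c) * norm (vsub (f y') c) + delta * delta) in Hmin.
    assert (Hb0 : 0 <= b) by (unfold b; pose proof (norm_nonneg _ (vsub (f y') c)); nra).
    pose proof (sqrt_tangent s2 b Hs2 Hb0) as Htan. fold s in Htan.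
    apply (Rmult_le_compat_l M) in Htan; [|assumption].
    replace (M * (s + (b - s2) / (2 * s))) with (M * s + M / s * ((b - s2) / 2)) in Htan
      by (field; lra).
    set (w := vsub (f y') (f y)) in *. pose proof (norm_nonneg _ w) as Hw0.
    assert (Hb : b - s2 = norm w * norm w + 2 * dot (vsub (f y) c) w).
    { unfold b, s2. rewrite !norm_sq.
      replace (vsub (f y') c) with (vadd (vsub (f y) c) w) by (unfold w; vext).
      rewrite dot_vadd_l, !dot_vadd_r, (dot_comm _ w (vsub (f y) c)). ring. }
    rewrite Hb in Htan.
    set (h := vsub y' y) in *. pose proof (norm_nonneg _ h) as Hh0.
    pose proof (cauchy_schwarz _ lam (vsub w (matvec (Df y) h))) as Hcs.
    rewrite dot_vsub_r in Hcs.
    assert (Hlw : dot lam w <= dot lam (matvec (Df y) h) + eta / 2 * norm h) by nra.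
    assert (Hww : M / s / 2 * (norm w * norm w) <= eta / 2 * norm h).
    { apply Rle_trans with (M / s / 2 * ((matnorm (Df y) + 1) * norm h * eta2)).
      - apply Rmult_le_compat_l; [lra|]. apply Rmult_le_compat; lra.
      - replace (M / s / 2 * ((matnorm (Df y) + 1) * norm h * eta2)) with (B * eta2 * norm h)
          by (unfold B; ring).
        now apply Rmult_le_compat_r. }
    assert (Hlam : dot lam w = M / s * dot (vsub (f y) c) w) by apply dot_vscal_l.
    assert (Hv' : dot v (vsub y' x) = dot v h + dot v (vsub y x)).
    { unfold h. rewrite !dot_vsub_r. ring. }
    rewrite dot_vsub_l, <- dot_matvec.
    assert (Hnn : e * norm (vsub y' x) <= e * (norm h + norm (vsub y x))).
    { apply Rmult_le_compat_l; lra. }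
    lra.
  - unfold lam. rewrite norm_vscal, Rabs_pos_eq by assumption.
    apply Rle_trans with M; [|unfold M; nra].
    apply Rle_trans with (M / s * s); [|right; field; lra].
    now apply Rmult_le_compat_l.
Qed.

Lemma seq_conv_close n (a b : nat -> Vec n) x phi : extraction phi ->
  (forall k, norm (vsub (a k) (b k)) <= / INR (S k)) ->
  seq_conv b x -> seq_conv (fun k => a (phi k)) x.
Proof.
  intros Hphi Hab Hb eps He. destruct (Hb (eps / 2) ltac:(lra)) as [N1 HN1].
  destruct (inv_nat_small (eps / 2) ltac:(lra)) as [N2 HN2].
  exists (Nat.max N1 N2). intros k Hk. pose proof (extraction_ge _ Hphi k).
  specialize (HN1 (phi k) ltac:(lia)). specialize (HN2 (phi k) ltac:(lia)).
  specialize (Hab (phi k)). pose proof (norm_triangle _ (b (phi k)) (a (phi k)) x). lra.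
Qed.

(** Approximate multipliers for regular normals converging to [v], with tolerance [1/(k+1)], are
    bounded; a cluster point is an exact multiplier with the sharp bound. *)
Lemma subregular_multiplier n l (f : Vec n -> Vec l) Df (C : Vec l -> Prop) S x v kappa r :
  closedV C -> 0 <= kappa -> 0 < r ->
  (forall y, norm (vsub y x) < r -> has_jac f y (Df y)) ->
  mat_cont_at Df x ->
  (forall y, norm (vsub y x) < r -> S y -> C (f y)) ->
  (forall y, norm (vsub y x) < r -> dist_le_scaled y S kappa (f y) C) ->
  lim_normal S x v ->
  exists lam, lim_normal C (f x) lam /\ matTvec (Df x) lam = v /\ norm lam <= kappa * norm v.
Proof.
  intros HC Hk Hr HJ HDf HSC HS [HSx [xs [vs [HSxs [Hxs [Hvs Hreg]]]]]].
  pose proof (norm_nonneg _ v) as Hv0.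
  destruct (Hxs (r / 2) ltac:(lra)) as [N1 HN1].
  destruct (seq_conv_bounded _ _ _ Hvs) as [N2 HN2].
  (* Dropping the first terms puts all base points in the half ball and makes the normals
     bounded. *)
  set (sh := fun k : nat => (Nat.max N1 N2 + k)%nat).
  assert (Hsh : extraction sh) by (intro k; unfold sh; lia).
  assert (Hb : forall k, norm (vsub (xs (sh k)) x) < r / 2 /\ norm (vs (sh k)) <= norm v + 1).
  { intro k. split; [apply HN1|apply HN2]; unfold sh; lia. }
  apply (seq_conv_extraction _ _ _ _ Hsh) in Hxs.
  apply (seq_conv_extraction _ _ _ _ Hsh) in Hvs.
  assert (Hap : forall k, exists t : Vec n * Vec l * (Vec l * Vec l),
    let '(y, c, (lam, lam')) := t in
    norm (vsub y (xs (sh k))) <= / INR (Datatypes.S k) /\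
    norm (vsub c (f (xs (sh k)))) <= / INR (Datatypes.S k) /\
    reg_normal C c lam' /\ norm (vsub lam' lam) <= / INR (Datatypes.S k) /\
    norm (vsub (matTvec (Df y) lam) (vs (sh k))) <= / INR (Datatypes.S k) /\
    norm lam <= kappa * norm (vs (sh k)) + / INR (Datatypes.S k)).
  { intro k. destruct (Hb k) as [Hxk _].
    assert (Hball : forall y, norm (vsub y (xs (sh k))) < r / 2 -> norm (vsub y x) < r).
    { intros y Hy. pose proof (norm_triangle _ (xs (sh k)) y x). lra. }
    destruct (approximate_multiplier n l f Df C S (xs (sh k)) (vs (sh k)) kappa (r / 2)
      (/ INR (Datatypes.S k)) HC Hk ltac:(lra) (inv_nat_pos k))
      as (y & c & lam & lam' & H1 & H2 & H3); auto.
    { apply HSC; [lra|apply HSxs]. }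
    exists (y, c, (lam, lam')). repeat split; try apply H3; lra. }
  apply functional_choice in Hap. destruct Hap as [t Ht].
  set (ys := fun k => fst (fst (t k))). set (cs := fun k => snd (fst (t k))).
  set (ls := fun k => fst (snd (t k))). set (ls' := fun k => snd (snd (t k))).
  assert (Hys : forall k, norm (vsub (ys k) (xs (sh k))) <= / INR (Datatypes.S k)).
  { intro k. specialize (Ht k). unfold ys. destruct (t k) as [[y c] [a b]]. apply Ht. }
  assert (Hcs : forall k, norm (vsub (cs k) (f (xs (sh k)))) <= / INR (Datatypes.S k)).
  { intro k. specialize (Ht k). unfold cs. destruct (t k) as [[y c] [a b]]. apply Ht. }
  assert (Hnc : forall k, reg_normal C (cs k) (ls' k)).
  { intro k. specialize (Ht k). unfold cs, ls'. destruct (t k) as [[y c] [a b]]. apply Ht. }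
  assert (Hls' : forall k, norm (vsub (ls' k) (ls k)) <= / INR (Datatypes.S k)).
  { intro k. specialize (Ht k). unfold ls, ls'. destruct (t k) as [[y c] [a b]]. apply Ht. }
  assert (Hst : forall k, norm (vsub (matTvec (Df (ys k)) (ls k)) (vs (sh k)))
                          <= / INR (Datatypes.S k)).
  { intro k. specialize (Ht k). unfold ys, ls. destruct (t k) as [[y c] [a b]]. apply Ht. }
  assert (Hls : forall k, norm (ls k) <= kappa * norm (vs (sh k)) + / INR (Datatypes.S k)).
  { intro k. specialize (Ht k). unfold ls. destruct (t k) as [[y c] [a b]]. apply Ht. }
  clearbody ys cs ls ls'. clear t Ht.
  set (M := kappa * (norm v + 1) + 1).
  assert (HM : forall k, norm (ls k) <= M).
  { intro k. apply Rle_trans with (1 := Hls k). apply Rplus_le_compat.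
    - apply Rmult_le_compat_l; [assumption|apply Hb].
    - rewrite <- Rinv_1. apply Rinv_le_contravar; [lra|]. apply (le_INR 1). lia. }
  assert (HM0 : 0 < M) by (unfold M; nra).
  destruct (bounded_extraction _ ls M HM) as [phi [lam [Hphi Hlam]]].
  exists lam. split; [|split].
  - split; [apply HSC; [rewrite norm_vsub_self; lra|assumption]|].
    exists (fun k => cs (phi k)), (fun k => ls' (phi k)). split; [|split; [|split]].
    + intro k. apply (Hnc (phi k)).
    + apply (seq_conv_close _ cs (fun k => f (xs (sh k))) _ _ Hphi Hcs).
      apply (has_jac_seq_conv _ _ f x (Df x)); [|assumption].
      apply HJ. rewrite norm_vsub_self. lra.
    + apply (seq_conv_close _ (fun k => ls' (phi k)) (fun k => ls (phi k)) _ (fun k => k)).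
      * intro k. lia.
      * intro k. apply Rle_trans with (1 := Hls' (phi k)).
        apply Rinv_le_contravar; [apply lt_0_INR; lia|]. apply le_INR.
        pose proof (extraction_ge _ Hphi k). lia.
      * assumption.
    + intro k. apply Hnc.
  (* Three errors of at most [eps / 4]: the approximate equation, the convergence of multipliers,
     and the continuity of the Jacobian applied to multipliers bounded by [M]. *)
  - apply eq_of_dist0. intros eps He.
    destruct (HDf (eps / (4 * M))) as [d [Hd HD]]; [apply Rdiv_lt_0_compat; lra|].
    pose proof (matnorm_nonneg _ _ (Df x)) as HDx.
    destruct (seq_conv_close _ _ _ _ _ Hphi Hys Hxs d Hd) as [K1 HK1].
    destruct (seq_conv_close _ _ _ _ _ Hphi Hst Hvs (eps / 4) ltac:(lra)) as [K2 HK2].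
    destruct (Hlam (eps / (4 * (matnorm (Df x) + 1)))) as [K3 HK3];
      [apply Rdiv_lt_0_compat; lra|].
    set (k := Nat.max K1 (Nat.max K2 K3)).
    specialize (HK1 k ltac:(lia)). specialize (HK2 k ltac:(lia)). specialize (HK3 k ltac:(lia)).
    set (y := ys (phi k)) in *. set (a := ls (phi k)) in *.
    assert (Ha : norm a <= M) by apply HM.
    pose proof (norm_triangle _ (matTvec (Df y) a) (matTvec (Df x) lam) v) as T1.
    pose proof (norm_triangle _ (matTvec (Df x) a) (matTvec (Df x) lam) (matTvec (Df y) a)) as T2.
    rewrite <- matTvec_vsub, <- matTvec_matsub in T2.
    pose proof (norm_matTvec _ _ (Df x) (vsub lam a)) as T3.
    pose proof (norm_matTvec _ _ (matsub (Df x) (Df y)) a) as T4.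
    rewrite norm_sub_sym in HK3.
    assert (T5 : matnorm (Df x) * norm (vsub lam a) <= eps / 4).
    { replace (eps / 4) with ((matnorm (Df x) + 1) * (eps / (4 * (matnorm (Df x) + 1))))
        by (field; lra).
      apply Rmult_le_compat; try lra. apply norm_nonneg. }
    assert (T6 : matnorm (matsub (Df x) (Df y)) * norm a <= eps / 4).
    { specialize (HD y HK1). rewrite matnorm_matsub_sym in HD.
      replace (eps / 4) with (eps / (4 * M) * M) by (field; lra).
      apply Rmult_le_compat; try lra; [apply matnorm_nonneg|apply norm_nonneg]. }
    lra.
  - apply Rle_cv_lim with (Un := fun k => norm (ls (phi k)))
      (Vn := fun k => kappa * norm (vs (sh (phi k))) + / INR (Datatypes.S (phi k))).
    + intro k. apply Hls.
    + now apply Un_cv_norm.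
    + replace (kappa * norm v) with (kappa * norm v + 0) by ring. apply CV_plus.
      * apply (CV_mult (fun _ => kappa)); [apply Un_cv_const|].
        apply (Un_cv_norm _ (fun k => vs (sh (phi k)))).
        now apply (seq_conv_extraction _ (fun k => vs (sh k))).
      * apply (Un_cv_extraction (fun k => / INR (Datatypes.S k)) 0 phi Hphi).
        intros eps He. destruct (inv_nat_small eps He) as [N HN]. exists N. intros k HNk.
        pose proof (inv_nat_pos k). unfold Rdist. rewrite Rminus_0_r, Rabs_pos_eq by lra.
        now apply HN.
Qed.

(** * Normals to convex and subamenable sets *)

(** Moving from a point of [Q] a small fraction [t] towards [c] stays in [Q], so for a regular
    normal the local inequality, divided by [t], becomes global. It then passes to the limit. *)
Lemma lim_normal_convex n (Q : Vec n -> Prop) w mu c :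
  convexV Q -> lim_normal Q w mu -> Q c -> dot mu (vsub c w) <= 0.
Proof.
  intros HQ [_ [ws [ms [HQws [Hws [Hms Hreg]]]]]] Hc.
  apply Rle_cv_lim with (Un := fun k => dot (ms k) (vsub c (ws k))) (Vn := fun _ => 0).
  - intro k. destruct (Hreg k) as [_ Hr]. apply le_epsilon. intros eps He.
    set (z := ws k) in *. set (D := norm (vsub c z)). assert (HD : 0 <= D) by apply norm_nonneg.
    destruct (Hr (eps / (D + 1))) as [d [Hd Hle]]; [apply Rdiv_lt_0_compat; lra|].
    set (t := Rmin 1 (d / (2 * (D + 1)))).
    assert (Ht : 0 < t /\ t <= 1 /\ t * (D + 1) < d).
    { assert (0 < d / (2 * (D + 1))) by (apply Rdiv_lt_0_compat; lra).
      split; [apply Rmin_glb_lt; lra|]. split; [apply Rmin_l|].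
      apply Rle_lt_trans with (d / (2 * (D + 1)) * (D + 1)).
      - apply Rmult_le_compat_r; [lra|apply Rmin_r].
      - replace (d / (2 * (D + 1)) * (D + 1)) with (d / 2) by (field; lra). lra. }
    specialize (Hle _ (HQ z c t (HQws k) Hc ltac:(lra))).
    replace (vsub (fun i => (1 - t) * z i + t * c i) z) with (vscal t (vsub c z)) in Hle by vext.
    rewrite norm_vscal, Rabs_pos_eq, dot_vscal_r in Hle by lra. fold D in Hle.
    specialize (Hle ltac:(nra)).
    apply (Rmult_le_reg_l t); [lra|]. apply Rle_trans with (1 := Hle).
    replace (eps / (D + 1) * (t * D)) with (t * eps * (1 - / (D + 1))) by (field; lra).
    assert (0 < / (D + 1)) by (apply Rinv_0_lt_compat; lra).
    assert (0 < t * eps) by nra. nra.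
  - apply Un_cv_dot; [assumption|]. apply seq_conv_vsub; [apply seq_conv_const|assumption].
  - apply Un_cv_const.
Qed.

(** Exchanges the Jacobian at a mean value point for the one at a base point, both being close to a
    reference Jacobian [D]. *)
Lemma dot_matvec_close l n (A B D : Mat l n) eta w h :
  matnorm (matsub A D) <= eta -> matnorm (matsub B D) <= eta ->
  dot w (matvec A h) <= dot w (matvec B h) + 2 * eta * norm w * norm h.
Proof.
  intros HA HB. pose proof (norm_nonneg _ w). pose proof (norm_nonneg _ h).
  pose proof (cauchy_schwarz _ w (matvec (matsub A D) h)) as H1.
  pose proof (cauchy_schwarz_neg _ w (matvec (matsub B D) h)) as H2.
  pose proof (norm_matvec _ _ (matsub A D) h) as H3.
  pose proof (norm_matvec _ _ (matsub B D) h) as H4.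
  rewrite matvec_matsub, dot_vsub_r in H1, H2. rewrite <- matvec_matsub in H1, H2.
  assert (norm w * norm (matvec (matsub A D) h) <= norm w * (eta * norm h)).
  { apply Rmult_le_compat_l; nra. }
  assert (norm w * norm (matvec (matsub B D) h) <= norm w * (eta * norm h)).
  { apply Rmult_le_compat_l; nra. }
  nra.
Qed.

(* Subregularity persists at the points near [zbar], so a normal to [C] at any
   of them is pulled back from a normal to the convex set [Q]. *)
Lemma subamenable_subsmooth l (C : Vec l -> Prop) zbar theta :
  subamenable C zbar -> 0 < theta ->
  exists rho, 0 < rho /\ forall z c lam, C c ->
    norm (vsub z zbar) < rho -> norm (vsub c zbar) < rho -> lim_normal C z lam ->
    dot lam (vsub c z) <= theta * norm lam * norm (vsub c z).
Proof.
  intros [_ (W & d & q & Q & HW & HWz & [Dq HDq] & HQc & HQ & HCQ &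
    kappa & delta & Hk & Hdel & Hsub)] Hth.
  destruct (HW zbar HWz) as [r0 [Hr0 HWr]].
  (* Multipliers satisfy [|mu| <= kappa |lam|], so exchanging Jacobians costs
     [2 eta kappa |lam| |c - z|], and [2 eta kappa < theta]. *)
  set (eta := theta / (2 * (kappa + 1))).
  assert (Heta : 0 < eta) by (apply Rdiv_lt_0_compat; lra).
  destruct (proj2 (HDq zbar HWz) eta Heta) as [d0 [Hd0 HD0]].
  set (r := Rmin r0 (Rmin delta d0)).
  assert (Hr : 0 < r /\ r <= r0 /\ r <= delta /\ r <= d0).
  { unfold r. split; [repeat apply Rmin_glb_lt; lra|].
    pose proof (Rmin_l r0 (Rmin delta d0)). pose proof (Rmin_r r0 (Rmin delta d0)).
    pose proof (Rmin_l delta d0). pose proof (Rmin_r delta d0). lra. }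
  clearbody r. destruct Hr as [Hr1 [Hr2 [Hr3 Hr4]]].
  exists (r / 2). split; [lra|]. intros z c lam Hc Hz Hcz Hlam.
  assert (Hball : forall y, norm (vsub y z) < r / 2 -> norm (vsub y zbar) < r).
  { intros y Hy. pose proof (norm_triangle _ z y zbar). lra. }
  assert (HWb : forall y, norm (vsub y zbar) < r -> W y) by (intros; apply HWr; lra).
  assert (HWc : W c) by (apply HWb; lra).
  assert (HWzz : W z) by (apply HWb; lra).
  destruct (subregular_multiplier _ _ q Dq Q C z lam kappa (r / 2) HQc Hk ltac:(lra))
    as [mu [Hmu [HDmu Hnmu]]].
  - intros y Hy. apply HDq. auto.
  - now apply HDq.
  - intros y Hy HCy. apply HCQ; auto.
  - intros y Hy b Hb eps He.
    destruct (Hsub y (HWb _ (Hball _ Hy)) ltac:(specialize (Hball _ Hy); lra) b Hb eps He)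
      as [s [[HsW HsQ] Hs]].
    exists s. split; [now apply HCQ|assumption].
  - assumption.
  (* Convexity gives [<mu, q c - q z> <= 0], and the mean value theorem turns it into a bound on
     [<mu, Dq(xi) (c - z)>]. It remains to replace [xi] by [z]. *)
  - pose proof (lim_normal_convex _ _ _ _ (q c) HQ Hmu (proj1 (HCQ c HWc) Hc)) as Hneg.
    destruct (mean_value _ _ q Dq zbar r z c mu) as [xi [Hxi Hmv]]; try lra.
    { intros y Hy. apply HDq. auto. }
    rewrite Hmv in Hneg. rewrite <- HDmu at 1. rewrite <- dot_matvec.
    pose proof (dot_matvec_close _ _ (Dq z) (Dq xi) (Dq zbar) eta mu (vsub c z)) as Hcl.
    pose proof (HD0 z ltac:(lra)). pose proof (HD0 xi ltac:(lra)).
    specialize (Hcl ltac:(lra) ltac:(lra)).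
    pose proof (norm_nonneg _ (vsub c z)). pose proof (norm_nonneg _ lam).
    assert (2 * eta * norm mu <= theta * norm lam).
    { apply Rle_trans with (2 * eta * (kappa * norm lam)).
      - apply Rmult_le_compat_l; lra.
      - assert (E : 2 * eta * kappa = theta - 2 * eta) by (unfold eta; field; lra). nra. }
    nra.
Qed.

(** * Consequences of Robinson stability *)

Lemma nbhdP_and (P : TopSpace) (V W : P -> Prop) p :
  nbhdP V p -> nbhdP W p -> nbhdP (fun q => V q /\ W q) p.
Proof.
  intros [O1 [H1 [Hp1 HV]]] [O2 [H2 [Hp2 HW]]].
  exists (fun q => O1 q /\ O2 q). split; [now apply open_inter|].
  split; [tauto|]. intros q [Hq1 Hq2]. auto.
Qed.

Lemma nbhdR_ball n (x : Vec n) r : 0 < r -> nbhdR (fun y => norm (vsub y x) < r) x.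
Proof. intro Hr. exists r. auto. Qed.

(** The estimate at [x = xbar], tested with [c = g pbar xbar], bounds the distance from [xbar] to
    the solution set by [kappa |g p xbar - g pbar xbar|], which is small by continuity. *)
Lemma RS_param_stable (P : TopSpace) n l (C : Vec l -> Prop) (g : P -> Vec n -> Vec l) Dg
  pbar xbar kappa :
  standing g Dg pbar xbar -> Gamma g C pbar xbar -> RS_modulus g C pbar xbar kappa ->
  param_stable g C pbar xbar.
Proof.
  intros [_ [Hg _]] Hgph [Hk [U [V [HU [HV HRS]]]]] U' [d [Hd HU']].
  destruct (Hg (d / (2 * (kappa + 1)))) as [V' [d' [HV' [Hd' Hg']]]].
  { apply Rdiv_lt_0_compat; lra. }
  exists (fun p => V p /\ V' p). split; [now apply nbhdP_and|].
  intros p [Hp Hp'].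
  assert (HUx : U xbar).
  { destruct HU as [r [Hr HU]]. apply HU. now rewrite norm_vsub_self. }
  destruct (HRS p xbar Hp HUx (g pbar xbar) Hgph (d / 2) ltac:(lra)) as [y [Hy Hle]].
  exists y. split; [assumption|]. apply HU'. rewrite norm_sub_sym.
  specialize (Hg' p xbar Hp'). rewrite norm_vsub_self in Hg'. specialize (Hg' Hd').
  apply Rle_lt_trans with (1 := Hle).
  set (N := norm (vsub (g p xbar) (g pbar xbar))) in *.
  assert (0 <= N) by apply norm_nonneg.
  assert ((kappa + 1) * N < d / 2).
  { replace (d / 2) with ((kappa + 1) * (d / (2 * (kappa + 1)))) by (field; lra).
    apply Rmult_lt_compat_l; lra. }
  nra.
Qed.

Lemma RS_partial_MSCQ (P : TopSpace) n l (C : Vec l -> Prop) (g : P -> Vec n -> Vec l)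
  pbar xbar kappa :
  RS_modulus g C pbar xbar kappa -> partial_MSCQ g C pbar xbar.
Proof.
  intros [Hk [U [V [[r [Hr HU]] [HV HRS]]]]].
  exists V, (fun x => norm (vsub x xbar) < r). split; [assumption|].
  split; [now apply nbhdR_ball|]. intros p x Hp _ Hx.
  exists (fun y => norm (vsub y x) < r - norm (vsub x xbar)), kappa.
  split; [apply nbhdR_ball; lra|]. split; [assumption|].
  intros y Hy. apply HRS; [assumption|]. apply HU.
  pose proof (norm_triangle _ x y xbar). lra.
Qed.

Lemma RS_BMP_modulus (P : TopSpace) n l (C : Vec l -> Prop) (g : P -> Vec n -> Vec l) Dg
  pbar xbar kappa :
  closedV C -> standing g Dg pbar xbar ->
  RS_modulus g C pbar xbar kappa -> BMP_modulus g Dg C pbar xbar kappa.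
Proof.
  intros HC [[U' [V' [[r' [Hr' HU']] [_ [HV' Hjac]]]]] _] [Hk [U [V [[r [Hr HU]] [HV HRS]]]]].
  split; [assumption|].
  set (s := Rmin r r'). assert (Hs : 0 < s /\ s <= r /\ s <= r').
  { split; [now apply Rmin_glb_lt|]. split; [apply Rmin_l|apply Rmin_r]. }
  clearbody s. destruct Hs as [Hs0 [Hsr Hsr']].
  (* Half the radius, so that the ball of radius [s / 2] around every admissible [x] stays where
     both the estimate and the Jacobians are available. *)
  exists (fun p => V p /\ V' p), (fun x => norm (vsub x xbar) < s / 2).
  split; [now apply nbhdP_and|]. split; [apply nbhdR_ball; lra|].
  intros p x v [Hp Hp'] _ Hx Hv.
  assert (Hball : forall y, norm (vsub y x) < s / 2 -> norm (vsub y xbar) < s).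
  { intros y Hy. pose proof (norm_triangle _ x y xbar). lra. }
  destruct (subregular_multiplier _ _ (g p) (Dg p) C (Gamma g C p) x v kappa (s / 2))
    as [lam [H1 [H2 H3]]]; try assumption; try lra.
  - intros y Hy. apply Hjac; [assumption|]. apply HU'. specialize (Hball y Hy). lra.
  - apply Hjac; [assumption|]. apply HU'. lra.
  - intros y _ Hy. exact Hy.
  - intros y Hy. apply HRS; [assumption|]. apply HU. specialize (Hball y Hy). lra.
  - exists lam. repeat split; assumption || apply H1.
Qed.

(** * From the multiplier bound back to Robinson stability *)

(** The minimization is confined to a closed ball because [f] is known to be continuous only there,
    so the whole solution set need not be closed. *)
Lemma exists_local_projection n l (f : Vec n -> Vec l) Df (C : Vec l -> Prop) a r x y0 :
  closedV C ->
  (forall y, norm (vsub y a) <= r -> has_jac f y (Df y)) ->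
  norm (vsub y0 a) <= r -> C (f y0) ->
  exists y, norm (vsub y a) <= r /\ C (f y) /\
    forall z, norm (vsub z a) <= r -> C (f z) -> norm (vsub x y) <= norm (vsub x z).
Proof.
  intros HC HJ Hy0 HCy0.
  destruct (exists_argmin (Vec n) (fun y => norm (vsub y a) <= r /\ C (f y))
    (fun y => norm (vsub x y))) as [y [[H1 H2] H3]]; [eauto| |].
  - intros u Hu.
    destruct (bounded_extraction _ u (norm a + r)) as [phi [y [Hphi Hy]]].
    { intro k. destruct (Hu k). pose proof (norm_vsub_le _ (u k) a). lra. }
    assert (Hyr : norm (vsub y a) <= r).
    { eapply seq_conv_norm_le; [exact (seq_conv_vsub _ _ _ _ _ Hy (seq_conv_const _ a))|].
      intro k. apply (Hu (phi k)). }
    exists y. split.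
    { split; [assumption|].
      apply (HC (fun k => f (u (phi k)))); [intro k; apply (Hu (phi k))|].
      now apply (has_jac_seq_conv _ _ f y (Df y)); [apply HJ|]. }
    intros eps N He.
    destruct (Un_cv_norm _ _ _ (seq_conv_vsub _ _ _ _ _ (seq_conv_const _ x) Hy) eps He)
      as [N' HN'].
    exists (phi (Nat.max N N')). split.
    { pose proof (extraction_ge _ Hphi (Nat.max N N')). lia. }
    specialize (HN' (Nat.max N N') ltac:(lia)). apply Rabs_def2 in HN'. lra.
  - exists y. auto.
Qed.

(** Squaring [|x - y| <= |x - z|] and expanding around [y] gives
    [<x - y, z - y> <= |z - y|^2 / 2]. *)
Lemma projection_reg_normal n (S : Vec n -> Prop) x y r :
  S y -> 0 < r ->
  (forall z, norm (vsub z y) < r -> S z -> norm (vsub x y) <= norm (vsub x z)) ->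
  reg_normal S y (vsub x y).
Proof.
  intros HS Hr H. apply (reg_normal_of_quadratic _ _ _ _ (/ 2) r HS Hr).
  intros z Hz Hd. specialize (H z Hd Hz). pose proof (norm_nonneg _ (vsub x y)).
  assert (Hsq : norm (vsub x y) * norm (vsub x y) <= norm (vsub x z) * norm (vsub x z)) by nra.
  rewrite !norm_sq in *.
  replace (vsub x z) with (vsub (vsub x y) (vsub z y)) in Hsq by vext.
  rewrite (dot_vsub_l _ (vsub x y) (vsub z y)), !(dot_vsub_r _ (vsub x y) (vsub z y)),
    (dot_comm _ (vsub z y) (vsub x y)) in Hsq.
  lra.
Qed.

Lemma lim_normal_of_reg n (S : Vec n -> Prop) x v : reg_normal S x v -> lim_normal S x v.
Proof.
  intro H. split; [apply H|]. exists (fun _ => x), (fun _ => v).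
  repeat split; try apply seq_conv_const; intros; apply H; assumption.
Qed.

(* [v = x - xt], for [xt] a projection of [x] on the solution set, is a normal
   with a multiplier [lam], so
   |x - xt|^2 = <lam, Dg (x - xt)> ~ <lam, g x - g xt> = <lam, g x - c> + <lam, c - g xt>,
   and the last term is negligible by subsmoothness. *)
Lemma BMP_RS_modulus (P : TopSpace) n l (C : Vec l -> Prop) (g : P -> Vec n -> Vec l) Dg
  pbar xbar kappa eps :
  closedV C -> standing g Dg pbar xbar -> subamenable C (g pbar xbar) ->
  param_stable g C pbar xbar -> BMP_modulus g Dg C pbar xbar kappa -> 0 < eps ->
  RS_modulus g C pbar xbar (kappa + eps).
Proof.
  intros HC [[U4 [V4 [[r4 [Hr4 HU4]] [_ [HV4 Hjac]]]]] [Hg HDg]] Hsub Hstab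
    [Hk [V1 [U1 [HV1 [[r1 [Hr1 HU1]] HBMP]]]]] He.
  split; [lra|].
  set (L := matnorm (Dg pbar xbar) + 1).
  assert (HL : 1 <= L) by (unfold L; pose proof (matnorm_nonneg _ _ (Dg pbar xbar)); lra).
  (* [B] is the total coefficient of [theta] in the final estimate, so that [theta B < eps] closes
     the argument. *)
  set (B := kappa + (kappa + eps) * kappa * (1 + L)).
  assert (HB : 0 <= B) by (unfold B; assert (0 <= (kappa + eps) * kappa) by nra; nra).
  set (theta := eps / (B + 1)).
  assert (Hth : 0 < theta /\ theta * B < eps).
  { assert (0 < theta) by (apply Rdiv_lt_0_compat; lra). split; [assumption|].
    assert (theta * (B + 1) = eps) by (unfold theta; field; lra). lra. }
  clearbody theta. destruct Hth as [Hth0 HthB].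
  destruct (subamenable_subsmooth _ C _ theta Hsub Hth0) as [rho [Hrho Hsm]].
  destruct (Hg (rho / 2) ltac:(lra)) as [V2 [r2 [HV2 [Hr2 Hg2]]]].
  (* The bound [theta / 2] serves to exchange Jacobians, the bound 1 to make [L] a Lipschitz
     constant. *)
  destruct (HDg (Rmin (theta / 2) 1)) as [V3 [r3 [HV3 [Hr3 HD3]]]].
  { apply Rmin_glb_lt; lra. }
  set (r := Rmin (Rmin r1 r2) (Rmin r3 r4)).
  assert (Hr : 0 < r /\ r <= r1 /\ r <= r2 /\ r <= r3 /\ r <= r4).
  { unfold r. split; [repeat apply Rmin_glb_lt; lra|].
    pose proof (Rmin_l (Rmin r1 r2) (Rmin r3 r4)). pose proof (Rmin_r (Rmin r1 r2) (Rmin r3 r4)).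
    pose proof (Rmin_l r1 r2). pose proof (Rmin_r r1 r2).
    pose proof (Rmin_l r3 r4). pose proof (Rmin_r r3 r4). lra. }
  clearbody r. destruct Hr as [Hr0 [Hrr1 [Hrr2 [Hrr3 Hrr4]]]].
  (* [d <= r / 6] puts the projection within [3 d <= r / 2] of [xbar]; [d <= eps rho / 4] settles
     the case where [c] is far from [g p x]. *)
  set (d := Rmin (r / 6) (eps * rho / 4)).
  assert (Hd : 0 < d /\ d <= r / 6 /\ d <= eps * rho / 4).
  { split; [apply Rmin_glb_lt; nra|]. split; [apply Rmin_l|apply Rmin_r]. }
  clearbody d. destruct Hd as [Hd0 [Hdr Hde]].
  destruct (Hstab _ (nbhdR_ball _ xbar d Hd0)) as [V5 [HV5 Hst]].
  exists (fun x => norm (vsub x xbar) < d),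
    (fun p => (V1 p /\ V2 p) /\ (V3 p /\ V4 p) /\ V5 p).
  split; [now apply nbhdR_ball|]. split; [repeat apply nbhdP_and; assumption|].
  intros p x [[Hp1 Hp2] [[Hp3 Hp4] Hp5]] Hx c Hc.
  assert (HJ : forall y, norm (vsub y xbar) < r -> has_jac (g p) y (Dg p y)).
  { intros y Hy. apply Hjac; [assumption|]. apply HU4. lra. }
  destruct (Hst p Hp5) as [xp [HGxp Hxp]].
  destruct (exists_local_projection _ _ (g p) (Dg p) C xbar (r / 2) x xp HC)
    as [xt [Hxt [HGxt Hmin]]]; [intros; apply HJ; lra|lra|exact HGxp|].
  pose proof (Hmin xp ltac:(lra) HGxp) as Hle.
  pose proof (norm_triangle _ xbar x xp) as T1. rewrite (norm_sub_sym _ xbar xp) in T1.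
  pose proof (norm_triangle _ x xt xbar) as T2. rewrite (norm_sub_sym _ xt x) in T2.
  set (v := vsub x xt) in *. set (D := norm v) in *.
  assert (HD : 0 <= D) by apply norm_nonneg.
  assert (HDd : D < 2 * d) by lra.
  assert (Hv : lim_normal (Gamma g C p) xt v).
  { apply lim_normal_of_reg. apply projection_reg_normal with (r := r / 2 - norm (vsub xt xbar)).
    - exact HGxt.
    - lra.
    - intros z Hz HGz. apply Hmin; [|exact HGz]. pose proof (norm_triangle _ xt z xbar). lra. }
  intros e Hee. exists xt. split; [exact HGxt|]. fold v D.
  set (N := norm (vsub (g p x) c)). assert (HN : 0 <= N) by apply norm_nonneg.
  enough (D <= (kappa + eps) * N) by lra.
  (* In the far case [D < 2 d <= eps rho / 2 <= eps N]. Otherwise [c] is within [rho] of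
     [g pbar xbar], and subsmoothness applies. *)
  destruct (Rle_lt_dec (rho / 2) N) as [Hfar|Hnear]; [nra|].
  destruct (HBMP p xt v Hp1 HGxt (HU1 xt ltac:(lra)) Hv) as [lam [[Hlam HDlam] Hnlam]].
  fold D in Hnlam. pose proof (norm_nonneg _ lam) as Hlam0.
  pose proof (Hg2 p x Hp2 ltac:(lra)) as Hgx.
  pose proof (Hg2 p xt Hp2 ltac:(lra)) as Hgxt.
  pose proof (norm_triangle _ (g p x) c (g pbar xbar)) as T3.
  rewrite (norm_sub_sym _ c (g p x)) in T3. fold N in T3.
  specialize (Hsm (g p xt) c lam Hc ltac:(lra) ltac:(lra) Hlam).
  pose proof (norm_triangle _ (g p x) c (g p xt)) as T4.
  rewrite (norm_sub_sym _ c (g p x)) in T4. fold N in T4.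
  assert (HLip : norm (vsub (g p x) (g p xt)) <= L * D).
  (* The mean value theorem is paired with the increment [w] itself, which gives
     [|w|^2 = <w, Dg(z) v>]. *)
  { set (w := vsub (g p x) (g p xt)). pose proof (norm_nonneg _ w).
    destruct (mean_value _ _ (g p) (Dg p) xbar r xt x w HJ ltac:(lra) ltac:(lra))
      as [z [Hz Hmv]].
    fold w v in Hmv. rewrite <- norm_sq in Hmv.
    pose proof (cauchy_schwarz _ w (matvec (Dg p z) v)) as Hcs.
    pose proof (matnorm_vsub_le _ _ (Dg p z) (Dg pbar xbar) v) as HDz. fold D in HDz.
    specialize (HD3 p z Hp3 ltac:(lra)). pose proof (Rmin_r (theta / 2) 1).
    assert (HDz' : norm (matvec (Dg p z) v) <= L * D).
    { apply Rle_trans with (1 := HDz). apply Rmult_le_compat_r; [assumption|]. unfold L; lra. }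
    destruct (Req_dec (norm w) 0); [nra|].
    apply (Rmult_le_reg_l (norm w)); nra. }
  assert (Hmain : D * D <= norm lam * N + theta * norm lam * (N + L * D) + theta * norm lam * D).
  { destruct (mean_value _ _ (g p) (Dg p) xbar r xt x lam HJ ltac:(lra) ltac:(lra))
      as [z [Hz Hmv]]. fold v in Hmv.
    pose proof (Rmin_l (theta / 2) 1).
    pose proof (HD3 p z Hp3 ltac:(lra)). pose proof (HD3 p xt Hp3 ltac:(lra)).
    pose proof (dot_matvec_close _ _ (Dg p xt) (Dg p z) (Dg pbar xbar) (theta / 2) lam v
      ltac:(lra) ltac:(lra)) as Hcl.
    fold D in Hcl. rewrite dot_matvec, HDlam, <- norm_sq in Hcl. fold D in Hcl.
    pose proof (cauchy_schwarz _ lam (vsub (g p x) c)) as Hcs. fold N in Hcs.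
    assert (theta * norm lam * norm (vsub c (g p xt)) <= theta * norm lam * (N + L * D)).
    { apply Rmult_le_compat_l; [nra|lra]. }
    rewrite dot_vsub_r in Hsm, Hcs, Hmv. lra. }
  (* If [(kappa + eps) N < D], replacing [N] in the estimate yields
     [(kappa + eps) D <= (kappa + theta B) D], impossible for [D > 0]. *)
  apply Rnot_lt_le. intro Hlt.
  assert (HDp : 0 < D) by nra.
  assert (H1 : D * D <= kappa * D * (N + theta * (N + L * D) + theta * D)).
  { apply Rle_trans with (1 := Hmain).
    replace (norm lam * N + theta * norm lam * (N + L * D) + theta * norm lam * D)
      with (norm lam * (N + theta * (N + L * D) + theta * D)) by ring.
    apply Rmult_le_compat_r; [|assumption].
    assert (0 <= L * D) by nra. nra. }
  assert (H2 : D <= kappa * (1 + theta) * N + kappa * theta * (1 + L) * D).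
  { apply (Rmult_le_reg_l D); [assumption|]. lra. }
  assert (H3 : kappa * (1 + theta) * ((kappa + eps) * N) <= kappa * (1 + theta) * D).
  { apply Rmult_le_compat_l; nra. }
  assert (H4 : (kappa + eps) * D <= (kappa + theta * B) * D).
  { apply Rle_trans with ((kappa + eps) * (kappa * (1 + theta) * N + kappa * theta * (1 + L) * D)).
    - apply Rmult_le_compat_l; lra.
    - unfold B. lra. }
  nra.
Qed.

Theorem theorem3p3 (P : TopSpace) (n l : nat) (C : Vec l -> Prop)
    (g : P -> Vec n -> Vec l) (Dg : P -> Vec n -> Mat l n)
    (pbar : P) (xbar : Vec n)
    (HC : closedV C)
    (Hstand : standing g Dg pbar xbar)
    (Hgph : Gamma g C pbar xbar) :
  (robinson_stable g C pbar xbar ->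
     (param_stable g C pbar xbar /\ partial_MSCQ g C pbar xbar /\
      partial_BMP g Dg C pbar xbar)
     /\ inf_le (BMP_modulus g Dg C pbar xbar) (RS_modulus g C pbar xbar))
  /\
  (subamenable C (g pbar xbar) ->
     (param_stable g C pbar xbar /\ partial_MSCQ g C pbar xbar /\
      partial_BMP g Dg C pbar xbar) ->
     robinson_stable g C pbar xbar
     /\ inf_le (RS_modulus g C pbar xbar) (BMP_modulus g Dg C pbar xbar)
     /\ inf_le (BMP_modulus g Dg C pbar xbar) (RS_modulus g C pbar xbar)).
Proof.
  assert (Hle : inf_le (BMP_modulus g Dg C pbar xbar) (RS_modulus g C pbar xbar)).
  { intros kappa Hk eps He. exists kappa. split; [now apply RS_BMP_modulus|lra]. }
  split.
  - intros [kappa Hk]. split; [split; [|split]|assumption].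
    + eapply RS_param_stable; eauto.
    + eapply RS_partial_MSCQ; eauto.
    + exists kappa. now apply RS_BMP_modulus.
  - intros Hsub [Hstab [_ [kappa Hk]]]. split; [|split; [|assumption]].
    + exists (kappa + 1). eapply BMP_RS_modulus; eauto. lra.
    + intros b Hb eps He. exists (b + eps). split; [|lra].
      eapply BMP_RS_modulus; eauto.
Qed.
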